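(* (i) Endow $\bar X$ with the QED metric $\bar d_2$. A generic point $\bar x\in\bar X$ has a neighborhood $U\subset\bar X$ in which the curvature is non-positive. At non-generic points, the curvature of $(\bar X,\bar d_2)$ is $+\infty$ (unbounded from above). That is: there is an open dense subset $\mathcal G\subset\bar X$ such that each $\bar x\in\mathcal G$ has a neighborhood in which the curvature is non-positive, while at every point of $\bar X\setminus\mathcal G$ the curvature is $+\infty$. (ii) Endow $\bar X$ with the TED metric $\bar d_1$. The metric space $(\bar X,\bar d_1)$ does not have locally unique geodesics anywhere, and the curvature of $(\bar X,\bar d_1)$ is $+\infty$ everywhere. Claims (i) and (ii) also hold with $\bar X$ replaced by any restricted tree-shape space $\bar Z\subset\bar X$, with the corresponding metrics on $\bar Z$ induced by $d_2$ and $d_1$.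
   Context: Setting. Fix integers $d,n\ge 1$ (in the paper $d=2$ or $3$) and a finite rooted ordered (planar) binary tree $\mathscr T=(V,E,r)$ with $E\neq\emptyset$: every non-leaf vertex has exactly two children, and the children of each vertex are totally ordered. The tree pre-shape space is the vector space $X=\prod_{e\in E}(\mathbb R^d)^n$, with elements $x=(x_e)_{e\in E}$. On $X$ consider the metrics $d_1(x,y)=\sum_{e\in E}\|x_e-y_e\|$ and $d_2(x,y)=\sqrt{\sum_{e\in E}\|x_e-y_e\|^2}$, where $\|\cdot\|$ is the Euclidean norm on $(\mathbb R^d)^n$. Equivalence. For $x\in X$, the collapsed tree of $x$ is the rooted ordered tree with edge attributes obtained from $\mathscr T$ by contracting every edge $e$ with $x_e=0$ (when an edge from $u$ down to $v$ is contracted, the children of $v$ are inserted, in order, at the position of $v$ among the children of $u$) and keeping the attribute $x_e$ on each remaining edge. Put $x\sim y$ iff the collapsed trees of $x$ and $y$ are isomorphic as rooted ordered trees with edge attributes. The space of ordered tree-like shapes is $\bar X=X/\sim$; write $\bar x$ for the class of $x$. Quotient metrics. For a metric $d$ on $X$, $$\bar d(\bar x,\bar y)=\inf\Big\{\sum_{i=1}^k d(x_i,y_i)\ :\ k\ge 1,\ x_1\in\bar x,\ y_i\sim x_{i+1}\ (1\le i<k),\ y_k\in\bar y\Big\}.$$ $\bar d_1$ (TED, tree edit distance) and $\bar d_2$ (QED, quotient Euclidean distance) are the resulting metrics on $\bar X$ for $d=d_1,d_2$. Restricted spaces. A subset $E'\subset E$ determines a combinatorial ordered rooted tree (its topology)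 by contracting in $\mathscr T$ all edges outside $E'$. Let $\mathcal E$ be a nonempty family of subsets of $E$ such that if $E'\in\mathcal E$ and $E''\subset E$ determines the same ordered topology as $E'$, then $E''\in\mathcal E$. The restricted pre-shape space is $Z=\bigcup_{E'\in\mathcal E}\{x\in X: x_e=0\text{ for }e\notin E'\}$, with the metric $d_Z$ induced by $d\in\{d_1,d_2\}$ (the length metric: infimum of $d$-lengths of paths in $Z$). The restricted tree-shape space is $\bar Z=Z/\sim_Z\subset\bar X$, where $\sim_Z$ is the restriction of $\sim$ to $Z$, with quotient metric $\bar d_Z$ defined by the same formula from $d_Z$. Generic. A property is generic in a metric space if it holds on an open dense subset; ''a generic point has property $P$'' means that $P$ holds on an open dense subset. Curvature. A geodesic triangle is compared with a triangle of the same side lengths in the simply connected model surface of constant curvature $\kappa$; a metric space is $CAT(\kappa)$ if it is geodesic (for $\kappa>0$, for pairs of points at distance $<\pi/\sqrt\kappa$) and geodesic triangles (of perimeter $<2\pi/\sqrt\kappa$ if $\kappa>0$) are no thicker than their comparison triangles, i.e. the distance from a vertex to a point on the opposite side is at most the corresponding comparison distance. A space (or an open subset) has curvature bounded above by $\kappa$ if each of its points has a ball around it that is $CAT(\kappa)$; non-positive curvature is the case $\kappa=0$. The curvature at a point is $+\infty$ if no ball around the point is $CAT(\kappa)$ for any $\kappa\in\mathbb R$. Geodesics are locally unique at a point if the point has a sufficiently small neighborhood within which any two points are joined by a unique geodesic; ''not locally unique anywhere'' means that this fails at every point.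
   Formalization: Claim (ii) for a restricted space Z̄ is proved when some E' in the family has at least two edges; otherwise Z̄ is a single point or Euclidean space, where geodesics are unique and the curvature is 0, so the claim is false. *)

(* Defs.v *)
From HB Require Import structures.
From mathcomp Require Import all_boot all_order all_algebra.
From mathcomp Require Import all_classical all_reals all_analysis.
From mathcomp Require Import generic_quotient.

Set Implicit Arguments.
Unset Strict Implicit.
Unset Printing Implicit Defensive.

Import Order.TTheory GRing.Theory Num.Theory numFieldNormedType.Exports.
Local Open Scope classical_set_scope.
Local Open Scope quotient_scope.
Local Open Scope ring_scope.

(** * Metric geometry of a distance function on a type *)

Definition dball (R : realType) (M : Type) (dist : M -> M -> R)
    (x : M) (r : R) : set M :=
  [set y | dist x y < r].

Definition dopen (R : realType) (M : Type) (dist : M -> M -> R)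
    (U : set M) : Prop :=
  forall x, U x -> exists2 r : R, 0 < r & dball dist x r `<=` U.

Definition ddense (R : realType) (M : Type) (dist : M -> M -> R)
    (U : set M) : Prop :=
  forall x (r : R), 0 < r -> exists2 y, U y & dball dist x r y.

(** Only the values of [g] on [[0, dist p q]] matter. *)
Definition geodesic (R : realType) (M : Type) (dist : M -> M -> R)
    (A : set M) (p q : M) (g : R -> M) : Prop :=
  [/\ g 0 = p,
      g (dist p q) = q,
      {in `[0, dist p q], forall t, A (g t)} &
      {in `[0, dist p q] &, forall s t, dist (g s) (g t) = `|s - t|}].

Definition locally_unique_geodesics (R : realType) (M : Type)
    (dist : M -> M -> R) (x : M) : Prop :=
  exists U : set M, [/\ dopen dist U, U x &
    forall p q, U p -> U q ->
      exists2 g, geodesic dist setT p q g &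
        forall g', geodesic dist setT p q g' ->
          {in `[0, dist p q], g' =1 g}].

(** The model surface of curvature [k] is realised in R^3 as a component of
    the quadric u_0^2 + sgn(k) (u_1^2 + u_2^2) = 1: the unit sphere for
    [k > 0], the affine plane u_0 = 1 for [k = 0], the upper sheet of the
    hyperboloid for [k < 0]. *)
Definition model_form (R : realType) (k : R) (u v : 'rV[R]_3) : R :=
  u 0 0 * v 0 0 + Num.sg k * (u 0 1 * v 0 1 + u 0 2 * v 0 2).

Definition model_surface (R : realType) (k : R) : set 'rV[R]_3 :=
  [set u | model_form k u u = 1 /\ (k <= 0 -> 0 < u 0 0)].

Definition arcosh (R : realType) (t : R) : R :=
  ln (t + Num.sqrt (t ^+ 2 - 1)).

Definition model_dist (R : realType) (k : R) (u v : 'rV[R]_3) : R :=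
  if 0 < k then acos (model_form k u v) / Num.sqrt k
  else if k < 0 then arcosh (model_form k u v) / Num.sqrt (- k)
  else Num.sqrt ((u 0 1 - v 0 1) ^+ 2 + (u 0 2 - v 0 2) ^+ 2).

Definition comparison_triangle (R : realType) (M : Type) (dist : M -> M -> R)
    (k : R) (p q r : M) (p' q' r' : 'rV[R]_3) : Prop :=
  [/\ [/\ model_surface k p', model_surface k q' & model_surface k r'],
      model_dist k p' q' = dist p q,
      model_dist k q' r' = dist q r &
      model_dist k r' p' = dist r p].

(** Comparison of the vertex [p] with the points of the opposite side [a];
    the other vertices are covered by permuting the triangle.  Under the
    perimeter bound the comparison triangle exists and is unique up to
    isometry, and [m'] is the unique point of its side [q' r'] at distance
    [t] from [q']. *)
Definition CAT (R : realType) (M : Type) (dist : M -> M -> R)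
    (A : set M) (k : R) : Prop :=
  (forall p q, A p -> A q -> (0 < k -> dist p q < trigo.pi / Num.sqrt k) ->
     exists g, geodesic dist A p q g) /\
  (forall p q r (a b c : R -> M),
     A p -> A q -> A r ->
     geodesic dist A q r a -> geodesic dist A r p b -> geodesic dist A p q c ->
     (0 < k -> dist p q + dist q r + dist r p < 2 * trigo.pi / Num.sqrt k) ->
     exists p' q' r', comparison_triangle dist k p q r p' q' r' /\
       {in `[0, dist q r], forall t, exists m',
         [/\ model_surface k m',
             model_dist k q' m' = t,
             model_dist k m' r' = dist q r - t &
             dist p (a t) <= model_dist k p' m']}).

Definition curvature_le_on (R : realType) (M : Type) (dist : M -> M -> R)
    (U : set M) (k : R) : Prop :=
  forall x, U x -> exists2 r : R, 0 < r & CAT dist (dball dist x r) k.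

Definition curvature_infinite_at (R : realType) (M : Type)
    (dist : M -> M -> R) (x : M) : Prop :=
  forall r k : R, 0 < r -> ~ CAT dist (dball dist x r) k.

Definition generically_nonpositively_curved (R : realType) (M : Type)
    (dist : M -> M -> R) : Prop :=
  exists G : set M,
    [/\ dopen dist G,
        ddense dist G,
        (forall x, G x -> exists U : set M,
           [/\ dopen dist U, U x & curvature_le_on dist U 0]) &
        (forall x, ~ G x -> curvature_infinite_at dist x)].

Definition nowhere_unique_infinitely_curved (R : realType) (M : Type)
    (dist : M -> M -> R) : Prop :=
  (forall x, ~ locally_unique_geodesics dist x) /\
  (forall x, curvature_infinite_at dist x).

(** * Length metric of a subset *)

Definition path_length (R : realType) (M : Type) (dist : M -> M -> R)
    (g : R -> M) : \bar R :=
  ereal_sup [set (\sum_(i < size s)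
                   dist (g (nth 0 (0 :: s) i)) (g (nth 0 s i)))%:E
            | s in itv_partition 0 1].

Definition is_path (R : realType) (M : Type) (dist : M -> M -> R)
    (A : set M) (x y : M) (g : R -> M) : Prop :=
  [/\ g 0 = x,
      g 1 = y,
      {in `[0, 1], forall t, A (g t)} &
      {in `[0, 1], forall s,
         dist (g s) (g t) @[t --> within `[0, 1] (nbhs s)] --> (0 : R)}].

Definition length_dist (R : realType) (M : Type) (dist : M -> M -> R)
    (A : set M) (x y : M) : R :=
  fine (ereal_inf [set path_length dist g | g in is_path dist A x y]).

(** * Quotient metric *)

Lemma ker_equiv_subproof (M S : Type) (f : M -> S) :
  equiv_class_of (fun x y => `[< f x = f y >]).
Proof.
split=> [x | x y | y x z /asboolP fxy /asboolP fyz]; first exact/asboolP.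
  by apply/asboolP/asboolP.
by apply/asboolP; rewrite fxy.
Qed.

(** The relation f x = f y. *)
Definition ker_equiv (M S : Type) (f : M -> S) : equiv_rel M :=
  EquivRelPack (ker_equiv_subproof f).

Definition quotient_dist (R : realType) (M : choiceType) (e : equiv_rel M)
    (dist : M -> M -> R) (p q : {eq_quot e}) : R :=
  inf [set l : R | exists (k : nat) (x y : nat -> M),
    [/\ \pi_({eq_quot e}) (x 0%N) = p,
        (forall i, (i < k)%N -> e (y i) (x i.+1)),
        \pi_({eq_quot e}) (y k) = q &
        l = \sum_(i < k.+1) dist (x i) (y i)]].

(** * Trees *)

Inductive btree : Type := Leaf | Bin of btree & btree.

(** [None] on the left (right) is the edge from the root to its left (right)
    child; [Some e] is the edge [e] of the left (right) subtree. *)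
Fixpoint edge (T : btree) : finType :=
  match T with
  | Leaf => void
  | Bin l r => (option (edge l) + option (edge r))%type
  end.

(** A rooted ordered tree with edge attributes, given by the list of the
    children of its root, each with the attribute of the edge leading to it.
    Two such trees are isomorphic iff they are equal. *)
Inductive otree (A : Type) : Type := ONode of seq (A * otree A).

(** The children of the root of [T] after contracting every edge [e] with
    [a e = None]; the other edges keep the attribute given by [a]. *)
Fixpoint contract_forest (A : Type) (T : btree) :
    (edge T -> option A) -> seq (A * otree A) :=
  match T return (edge T -> option A) -> seq (A * otree A) with
  | Leaf => fun _ => [::]
  | Bin l r => fun a =>
      let fl := contract_forest (fun e : edge l => a (inl (Some e))) in
      let fr := contract_forest (fun e : edge r => a (inr (Some e))) in
      (if a (inl None) is Some v then [:: (v, ONode fl)] else fl) ++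
      (if a (inr None) is Some v then [:: (v, ONode fr)] else fr)
  end.

Definition contract_tree (A : Type) (T : btree)
    (a : edge T -> option A) : otree A :=
  ONode (contract_forest a).

Definition topology_of (T : btree) (E : {set edge T}) : otree unit :=
  contract_tree (fun e => if e \in E then Some tt else None).

(** * Tree-like shapes *)

(** A point of (R^d)^n is an n x d matrix whose rows are the n vectors. *)
Definition preshape (R : realType) (d n : nat) (T : btree) :=
  {ffun edge T -> 'M[R]_(n, d)}.

Definition enorm (R : realType) (d n : nat) (A : 'M[R]_(n, d)) : R :=
  Num.sqrt (\sum_i \sum_j A i j ^+ 2).

Definition dist1 (R : realType) (d n : nat) (T : btree)
    (x y : preshape R d n T) : R :=
  \sum_e enorm (x e - y e).

Definition dist2 (R : realType) (d n : nat) (T : btree)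
    (x y : preshape R d n T) : R :=
  Num.sqrt (\sum_e enorm (x e - y e) ^+ 2).

Definition collapse (R : realType) (d n : nat) (T : btree)
    (x : preshape R d n T) : otree 'M[R]_(n, d) :=
  contract_tree (fun e => if x e == 0 then None else Some (x e)).

Definition shape_equiv (R : realType) (d n : nat) (T : btree) :
    equiv_rel (preshape R d n T) :=
  ker_equiv (@collapse R d n T).

Definition tree_shape (R : realType) (d n : nat) (T : btree) :=
  {eq_quot (shape_equiv R d n T)}.

Definition TED (R : realType) (d n : nat) (T : btree) :
    tree_shape R d n T -> tree_shape R d n T -> R :=
  quotient_dist (@dist1 R d n T).

Definition QED (R : realType) (d n : nat) (T : btree) :
    tree_shape R d n T -> tree_shape R d n T -> R :=
  quotient_dist (@dist2 R d n T).

(** * Restricted shape spaces *)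

Definition topology_closed (T : btree) (F : {set {set edge T}}) : Prop :=
  forall E1 E2 : {set edge T},
    E1 \in F -> topology_of E2 = topology_of E1 -> E2 \in F.

Definition restricted_preshape (R : realType) (d n : nat) (T : btree)
    (F : {set {set edge T}}) : set (preshape R d n T) :=
  [set x | exists2 E : {set edge T}, E \in F & forall e, e \notin E -> x e = 0].

Arguments restricted_preshape : clear implicits.
Arguments restricted_preshape R d n {T} F.

Definition restricted_equiv (R : realType) (d n : nat) (T : btree)
    (F : {set {set edge T}}) : equiv_rel (restricted_preshape R d n F) :=
  ker_equiv (fun x : restricted_preshape R d n F => collapse (val x)).

Definition restricted_shape (R : realType) (d n : nat) (T : btree)
    (F : {set {set edge T}}) :=
  {eq_quot (restricted_equiv R d n F)}.

Definition restricted_TED (R : realType) (d n : nat) (T : btree)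
    (F : {set {set edge T}}) :
    restricted_shape R d n F -> restricted_shape R d n F -> R :=
  quotient_dist (fun x y : restricted_preshape R d n F =>
    length_dist (@dist1 R d n T) (restricted_preshape R d n F) (val x) (val y)).

Definition restricted_QED (R : realType) (d n : nat) (T : btree)
    (F : {set {set edge T}}) :
    restricted_shape R d n F -> restricted_shape R d n F -> R :=
  quotient_dist (fun x y : restricted_preshape R d n F =>
    length_dist (@dist2 R d n T) (restricted_preshape R d n F) (val x) (val y)).

(* Main.v *)
(** Up to the identification, a shape is determined by the combinatorial tree of
    its nonzero edges and the preorder list of their attributes.  Hence two
    equivalent shapes are related by a linear isometry between the coordinate
    subspaces of their supports which preserves equivalence classes, and the
    quotient metric is the infimum of the lengths of chains of straight moves
    inside the coordinate subspaces of the (restricted) pre-shape space.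

    Near any shape the chain metric is a cone: homotheties centred at the finitely
    many representatives of the shape scale it.  A ball that is CAT(k) for some
    [k] therefore contains arbitrarily reduced copies of all small triangles, and
    in the limit the comparison with curvature [k] becomes Euclidean, so that the
    centre has a neighbourhood of nonpositive curvature.  The set of centres of
    CAT balls is thus open, and the curvature is infinite on its complement.  It
    is dense because it contains the shapes no representative of which can be
    expanded within the restricted space; around these the shape space is
    isometric to a ball of a Euclidean space.  For the TED metric that ball is
    one of an l1 sum with at least two factors, which contains taxicab squares;
    their two geodesics contradict both uniqueness and CAT(0), hence CAT(k). *)

Require Import Defs.
From mathcomp Require Import all_boot all_order all_algebra.
From mathcomp Require Import all_classical all_reals all_analysis.
From mathcomp Require Import ring lra generic_quotient.

Set Implicit Arguments.
Unset Strict Implicit.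
Unset Printing Implicit Defensive.

Import Order.TTheory GRing.Theory Num.Theory numFieldNormedType.Exports.
Local Open Scope classical_set_scope.
Local Open Scope ring_scope.

(** * Labelled ordered trees *)

Section Otree.
Variables A B : Type.

Fixpoint labels (t : otree A) : seq A :=
  let: ONode s := t in flatten [seq p.1 :: labels p.2 | p <- s].

Fixpoint relabel (f : A -> B) (t : otree A) : otree B :=
  let: ONode s := t in ONode [seq (f p.1, relabel f p.2) | p <- s].

(** This is contraction of a tree that is already collapsed; it shows that contracting further
    depends only on the collapsed tree. *)
Fixpoint prune (f : A -> option B) (t : otree A) : seq (B * otree B) :=
  let: ONode s := t in
  flatten [seq if f p.1 is Some v then [:: (v, ONode (prune f p.2))]
               else prune f p.2 | p <- s].

End Otree.

(** Splitting off the first child and treating its siblings as a tree of their own turns the nested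
    recursion into one induction. *)
Lemma otree_list_ind (A : Type) (P : otree A -> Prop) :
  P (ONode [::]) ->
  (forall a t s, P t -> P (ONode s) -> P (ONode ((a, t) :: s))) ->
  forall t, P t.
Proof.
move=> P0 PS.
exact: (fix IH t := match t return P t with ONode s =>
  (fix IHs s : P (ONode s) := match s return P (ONode s) with
   | [::] => P0
   | p :: s' => match p return P (ONode (p :: s')) with
                | (a, t) => PS a t s' (IH t) (IHs s')
                end
   end) s end).
Qed.

Lemma size_labels_relabel (A B : Type) (f : A -> B) (t : otree A) :
  size (labels (relabel f t)) = size (labels t).
Proof.
elim/otree_list_ind: t => [//|a t s IHt IHs] /=.
by rewrite !size_cat IHt; congr (_ + _).+1; exact: IHs.
Qed.

(** The unlabelled tree fixes the number of labels in each child's subtree, so the preorder list can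
    be cut back into the blocks of the children. *)
Lemma otree_eq (A : Type) (t t' : otree A) :
  relabel (fun=> tt) t = relabel (fun=> tt) t' -> labels t = labels t' ->
  t = t'.
Proof.
elim/otree_list_ind: t t' => [[[]//]|a t s IHt IHs [[//|[a' t'] s']]] /=.
move=> [et es] [-> le].
have sz : size (labels t) = size (labels t').
  by rewrite -(size_labels_relabel (fun=> tt) t) et size_labels_relabel.
have lt : labels t = labels t'.
  by move: (congr1 (take (size (labels t))) le); rewrite take_size_cat // take_size_cat.
have ls := congr1 (drop (size (labels t))) le.
rewrite drop_size_cat // drop_size_cat // in ls.
rewrite (IHt _ et lt); congr (ONode (_ :: _)).
suff [] : ONode s = ONode s' by [].
by apply: IHs => //=; rewrite es.
Qed.

(** * Contraction and the preorder of edges *)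

Section Contract.
Variable A : Type.

Fixpoint edge_seq (T : btree) : seq (edge T) :=
  match T return seq (edge T) with
  | Leaf => [::]
  | Bin l r =>
     [seq inl e | e <- None :: [seq Some e | e <- edge_seq l]] ++
     [seq inr e | e <- None :: [seq Some e | e <- edge_seq r]]
  end.

Lemma mem_edge_seq T (e : edge T) : e \in edge_seq T.
Proof.
elim: T e => [[]|l IHl r IHr] [e|e] /=; rewrite -!(map_cons, cat_cons).
- rewrite inE mem_cat; case: e => [e|]; last by rewrite eqxx.
  by rewrite !map_f ?orbT.
- rewrite inE mem_cat inE; case: e => [e|]; last by rewrite eqxx ?orbT.
  by rewrite !map_f ?orbT.
Qed.

Lemma uniq_edge_seq T : uniq (edge_seq T).
Proof.
elim: T => [//|l IHl r IHr].
have u (I : finType) (s : seq I) : uniq s -> uniq (None :: [seq Some e | e <- s]).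
  move=> us; rewrite /= map_inj_uniq ?us ?andbT; last by move=> ? ? [].
  by apply/negP => /mapP[].
rewrite -[edge_seq _]/([seq inl e | e <- None :: [seq Some e | e <- edge_seq l]] ++
  [seq inr e | e <- None :: [seq Some e | e <- edge_seq r]]).
rewrite cat_uniq; apply/and3P; split.
- by rewrite map_inj_uniq ?u // => ? ? [].
- by apply/hasPn => e /mapP[e' _ ->]; apply/negP => /mapP[].
- by rewrite map_inj_uniq ?u // => ? ? [].
Qed.

Lemma labels_contract T (a : edge T -> option A) :
  labels (contract_tree a) = pmap a (edge_seq T).
Proof.
rewrite /contract_tree; elim: T a => [//|l IHl r IHr] a.
have step (o : option A) s : labels (ONode
    (if o is Some v then [:: (v, ONode s)] else s)) =
  (if o is Some v then [:: v] else [::]) ++ labels (ONode s).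
  by case: o => //= v; rewrite cats0.
have labels_cat (s s' : seq (A * otree A)) :
  labels (ONode (s ++ s')) = labels (ONode s) ++ labels (ONode s').
  by rewrite /= map_cat flatten_cat.
have pmap_map (I J : Type) (g : J -> option A) (f : I -> J) s :
  pmap g [seq f i | i <- s] = pmap (g \o f) s by elim: s => //= i s ->.
rewrite [contract_forest _]/= labels_cat !step IHl IHr.
rewrite [edge_seq _]/= pmap_cat /= !pmap_map.
by case: (a (inl None)); case: (a (inr None)).
Qed.

Lemma prune_contract B (f : A -> option B) T (a : edge T -> option A) :
  prune f (contract_tree a) = contract_forest (fun e => obind f (a e)).
Proof.
rewrite /contract_tree; elim: T a => [//|l IHl r IHr] a.
have step (o : option A) s : prune f (ONode
    (if o is Some v then [:: (v, ONode s)] else s)) =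
  (if obind f o is Some v then [:: (v, ONode (prune f (ONode s)))]
   else prune f (ONode s)).
  by case: o => //= v; case: (f v) => //=; rewrite cats0.
have prune_cat (s s' : seq (A * otree A)) :
  prune f (ONode (s ++ s')) = prune f (ONode s) ++ prune f (ONode s').
  by rewrite /= map_cat flatten_cat.
by rewrite [contract_forest _]/= prune_cat !step IHl IHr.
Qed.

(** A second contraction can be computed from the collapsed tree alone, by [prune]. *)
Lemma contract_obind B (f : A -> option B) T (a a' : edge T -> option A) :
  contract_tree a = contract_tree a' ->
  contract_tree (fun e => obind f (a e)) = contract_tree (fun e => obind f (a' e)).
Proof.
by move=> /(congr1 (prune f)); rewrite !prune_contract /contract_tree => ->.
Qed.

Lemma relabel_contract B (f : A -> B) T (a : edge T -> option A) :
  relabel f (contract_tree a) = contract_tree (fun e => omap f (a e)).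
Proof.
rewrite /contract_tree; elim: T a => [//|l IHl r IHr] a.
have IHl' := IHl (fun e => a (inl (Some e))).
have IHr' := IHr (fun e => a (inr (Some e))).
move: IHl' IHr' => /= [IHl'] [IHr'].
by rewrite map_cat; congr (ONode (_ ++ _)); [move: (a (inl None)) | move: (a (inr None))];
  case=> [v|] /=; rewrite ?IHl' ?IHr'.
Qed.

Lemma contract_eq T (a a' : edge T -> option A) :
  (forall e, a e = a' e) -> contract_tree a = contract_tree a'.
Proof. by move=> aa'; congr contract_tree; apply/funext. Qed.

End Contract.

(** * Shapes with the same collapse *)

Section Collapse.
Variables (R : realType) (d n : nat) (T : btree).
Local Notation X := (preshape R d n T).
Implicit Types (x y w : X) (e : edge T).

Definition supp x : {set edge T} := [set e | x e != 0].

Lemma suppPn x e : e \notin supp x -> x e = 0.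
Proof. by rewrite inE negbK => /eqP. Qed.

Lemma subset_suppP x (E : {set edge T}) :
  reflect (forall e, e \notin E -> x e = 0) (supp x \subset E).
Proof.
apply: (iffP fintype.subsetP) => h e.
  by move=> eE; apply: suppPn; apply: contra eE; exact: h.
by rewrite inE; apply: contraNT => /h ->.
Qed.

Let nz (v : 'M[R]_(n, d)) := if v == 0 then None else Some v.

Lemma labels_collapse x : labels (collapse x) = [seq x e | e <- edge_seq T & e \in supp x].
Proof.
rewrite /collapse labels_contract.
elim: (edge_seq T) => //= e s IH; rewrite inE.
by case: eqVneq => //= _; rewrite IH.
Qed.

Lemma topology_supp x : topology_of (supp x) = relabel (fun=> tt) (collapse x).
Proof.
rewrite /collapse relabel_contract; apply: contract_eq => e.
by rewrite inE; case: eqVneq.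
Qed.

Lemma collapse_inj_supp x y : collapse x = collapse y -> supp x = supp y -> x = y.
Proof.
move=> cxy sxy; apply/ffunP => e.
have [ex|ex] := boolP (e \in supp x); last by rewrite !suppPn // -sxy.
move: cxy => /(congr1 (@labels _)); rewrite !labels_collapse sxy => /eq_in_map; apply.
by rewrite mem_filter -sxy ex mem_edge_seq.
Qed.

(** Applied to the preorder-preserving bijection [s] from [E'] onto the support
    of a shape with the same topology. *)
Definition transport (E' : {set edge T}) (s : edge T -> edge T) (x : X) : X :=
  [ffun e => if e \in E' then x (s e) else 0].

(** With equal topologies and edges matched in preorder, the two trees that keep all edges of [E]
    and [E'] agree by [otree_eq]; pruning their zero labels yields the collapsed trees. *)
Lemma collapse_transport (E E' : {set edge T}) (s : edge T -> edge T) x :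
  topology_of E = topology_of E' ->
  [seq s e | e <- edge_seq T & e \in E'] = [seq e <- edge_seq T | e \in E] ->
  supp x \subset E -> collapse (transport E' s x) = collapse x.
Proof.
move=> top ss /subset_suppP xE.
(* Zero values are kept as labels at first, because [x] may vanish on part of [E] while the matching
   runs over all of it. *)
pose a (E : {set edge T}) (x : X) e := if e \in E then Some (x e) else None.
have aE (D : {set edge T}) (u : X) : (forall e, e \notin D -> u e = 0) ->
    collapse u = contract_tree (fun e => obind nz (a D u e)).
  move=> uD; apply: contract_eq => e; rewrite /a /nz.
  by have [eD|eD] := boolP (e \in D); rewrite //= uD // eqxx.
rewrite (aE E x) // (aE E') => [|e]; last by rewrite ffunE => /negPf ->.
apply: contract_obind; apply: otree_eq.
  rewrite !relabel_contract.
  have rE D u : contract_tree (fun e => omap (fun=> tt) (a D u e)) = topology_of D.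
    by apply: contract_eq => e; rewrite /a; case: ifP.
  by rewrite !rE.
rewrite !labels_contract.
have lE D u : pmap (a D u) (edge_seq T) = [seq u e | e <- edge_seq T & e \in D].
  by elim: (edge_seq T) => //= e r IH; rewrite /a; case: ifP => //= _; rewrite IH.
rewrite !lE -ss -map_comp; apply/eq_in_map => e.
by rewrite mem_filter => /andP[eE' _]; rewrite /= ffunE eE'.
Qed.

(** The map [s] sends the i-th support edge of [y] to the i-th support edge of [x] in preorder. *)
Lemma collapse_transportP x y : collapse x = collapse y ->
  exists s, [/\ {in supp y &, injective s},
    s @: supp y = supp x,
    transport (supp y) s x = y &
    forall w, supp w \subset supp x ->
      collapse (transport (supp y) s w) = collapse w].
Proof.
move=> cxy.
pose L (E : {set edge T}) := [seq e <- edge_seq T | e \in E].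
have top : topology_of (supp x) = topology_of (supp y).
  by rewrite !topology_supp cxy.
have lab : [seq x e | e <- L (supp x)] = [seq y e | e <- L (supp y)].
  by rewrite -!labels_collapse cxy.
have sz : size (L (supp x)) = size (L (supp y)).
  by move: lab => /(congr1 size); rewrite !size_map.
have uL E : uniq (L E) by rewrite filter_uniq // uniq_edge_seq.
have mL E e : (e \in L E) = (e \in E) by rewrite mem_filter mem_edge_seq andbT.
pose s e := nth e (L (supp x)) (index e (L (supp y))).
have ss : [seq s e | e <- L (supp y)] = L (supp x).
  case: (L (supp y)) (uL (supp y)) sz @s => [|e0 r] ur sz s.
    by apply/esym/size0nil; rewrite sz.
  apply: (@eq_from_nth _ e0); rewrite ?size_map // => i ir.
  rewrite (nth_map e0) // /s index_uniq //; apply: set_nth_default.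
  by rewrite sz.
exists s; split.
- move=> e e'; rewrite -!mL => eL e'L see'.
  have := uL (supp x); rewrite -ss => us.
  have ni e1 : e1 \in L (supp y) ->
      nth (s e) [seq s e | e <- L (supp y)] (index e1 (L (supp y))) = s e1.
    by move=> e1L; rewrite (nth_map e1) ?index_mem // nth_index.
  move: see'; rewrite -ni // -[s e']ni // => /eqP.
  rewrite nth_uniq ?size_map ?index_mem // => /eqP ie.
  by rewrite -(nth_index e eL) ie nth_index.
- apply/setP => e; apply/imsetP/idP => [[e' e'y ->]|].
    by rewrite -mL -ss map_f // mL.
  rewrite -mL -ss => /mapP[e' e'L ->]; exists e' => //; by rewrite -mL.
- apply/ffunP => e; rewrite ffunE; case: ifPn => [ey|/suppPn -> //].
  move: lab; rewrite -ss -map_comp => /eq_in_map; apply; by rewrite mL.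
- by move=> w; apply: collapse_transport.
Qed.

End Collapse.

(** * Shapes supported on a single edge *)

Section SingleEdge.
Variables (R : realType) (d n : nat) (T : btree).
Local Notation X := (preshape R d n T).

Definition single_edge (e : edge T) (v : 'M[R]_(n, d)) : X :=
  [ffun e' => if e' == e then v else 0].

Lemma supp_single_edge e v : supp (single_edge e v) \subset [set e]%SET.
Proof. by apply/subset_suppP => e'; rewrite finset.inE ffunE => /negPf ->. Qed.

(** All other edges are contracted, so only one edge at the root remains and its former place in the
    tree is forgotten. *)
Lemma collapse_single_edge e e' v : collapse (single_edge e v) = collapse (single_edge e' v).
Proof.
have [->//|v0] := eqVneq v 0; first by congr collapse; apply/ffunP => f; rewrite !ffunE !if_same.
rewrite /collapse.
suff P (S : btree) (f : edge S) : contract_forest (fun g : edge S =>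
    if (if g == f then v else 0) == 0 then None else Some (if g == f then v else 0))
    = [:: (v, ONode [::])].
  have singleE f : contract_tree (fun g => if single_edge f v g == 0 then None else Some (single_edge f v g))
      = ONode [:: (v, ONode [::])].
    by rewrite -(P T f); congr (ONode (contract_forest _)); apply/funext => g; rewrite ffunE.
  by rewrite !singleE.
have Z (S' : btree) : @contract_forest 'M[R]_(n, d) S' (fun=> None) = [::].
  by elim: S' => //= l -> r ->.
have ZE (S' : btree) (a : edge S' -> option 'M[R]_(n, d)) : (forall g, a g = None) ->
    contract_forest a = [::].
  by move=> a0; rewrite -(Z S'); congr contract_forest; apply/funext.
elim: S f => [[]|l IHl r IHr] [[f|]|[f|]] /=.
- rewrite eqxx /= (ZE r) // cats0.
  by rewrite -(IHl f); congr contract_forest; apply/funext => g.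
- by rewrite !eqxx /= (negPf v0) (ZE l) ?(ZE r) //= => g; rewrite ?eqxx.
- rewrite eqxx /= (ZE l) //=.
  by rewrite -(IHr f); congr contract_forest; apply/funext => g.
- by rewrite !eqxx /= (negPf v0) (ZE l) ?(ZE r) //= => g; rewrite ?eqxx.
Qed.

End SingleEdge.

(** * Norms on the pre-shape space *)

Section L2.
Variable R : realType.

(** Minkowski's inequality, from Cauchy-Schwarz. *)
Lemma sqrt_sum_sqrD (I : finType) (f g : I -> R) :
  Num.sqrt (\sum_i (f i + g i) ^+ 2) <=
  Num.sqrt (\sum_i f i ^+ 2) + Num.sqrt (\sum_i g i ^+ 2).
Proof.
have s0 (h : I -> R) : 0 <= \sum_i h i ^+ 2 by apply: sumr_ge0 => i _; exact: sqr_ge0.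
set a := Num.sqrt (\sum_i f i ^+ 2); set b := Num.sqrt (\sum_i g i ^+ 2).
have a2 : \sum_i f i ^+ 2 = a ^+ 2 by rewrite sqr_sqrtr.
have b2 : \sum_i g i ^+ 2 = b ^+ 2 by rewrite sqr_sqrtr.
have a0 : 0 <= a := sqrtr_ge0 _. have b0 : 0 <= b := sqrtr_ge0 _.
have z (h : I -> R) : \sum_i h i ^+ 2 = 0 -> forall i, h i = 0.
  move=> /eqP; rewrite psumr_eq0 => [/allP h0 i|i _]; last exact: sqr_ge0.
  by apply/eqP; rewrite -sqrf_eq0; apply: h0; rewrite mem_index_enum.
have CS : \sum_i f i * g i <= a * b.
  have [a00|an] := eqVneq a 0.
    rewrite big1 ?a00 ?mul0r // => i _.
    by rewrite (z f) ?mul0r // a2 a00 expr0n.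
  have [b00|bn] := eqVneq b 0.
    rewrite big1 ?b00 ?mulr0 // => i _.
    by rewrite (z g) ?mulr0 // b2 b00 expr0n.
  have := s0 (fun i => b * f i - a * g i).
  have -> : \sum_i (b * f i - a * g i) ^+ 2 =
      b ^+ 2 * \sum_i f i ^+ 2 + a ^+ 2 * \sum_i g i ^+ 2 - (2 * a * b) * \sum_i f i * g i.
    rewrite !mulr_sumr -big_split -sumrB /=; apply: eq_bigr => i _; ring.
  rewrite a2 b2.
  have -> : b ^+ 2 * a ^+ 2 + a ^+ 2 * b ^+ 2 - 2 * a * b * (\sum_i f i * g i) =
     (2 * (a * b)) * (a * b - \sum_i f i * g i) by ring.
  rewrite pmulr_rge0 ?subr_ge0 // !mulr_gt0 // lt_neqAle eq_sym ?an ?bn //.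
have ab0 : 0 <= a + b by apply: addr_ge0.
rewrite -[leRHS]ger0_norm // -sqrtr_sqr ler_wsqrtr //.
have -> : \sum_i (f i + g i) ^+ 2 = a ^+ 2 + b ^+ 2 + 2 * \sum_i f i * g i.
  rewrite -a2 -b2 mulr_sumr -!big_split /=; apply: eq_bigr => i _; ring.
rewrite sqrrD mulr2n; lra.
Qed.

End L2.

Section Norms.
Variables (R : realType) (d n : nat).
Implicit Types A B : 'M[R]_(n, d).

Lemma enormE A : enorm A = Num.sqrt (\sum_(p : 'I_n * 'I_d) A p.1 p.2 ^+ 2).
Proof. by rewrite /enorm pair_big. Qed.

Lemma enorm_ge0 A : 0 <= enorm A. Proof. exact: sqrtr_ge0. Qed.

Lemma ler_enormD A B : enorm (A + B) <= enorm A + enorm B.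
Proof.
rewrite !enormE; under eq_bigr do rewrite mxE; exact: sqrt_sum_sqrD.
Qed.

Lemma enormZ a A : enorm (a *: A) = `|a| * enorm A.
Proof.
rewrite !enormE; under eq_bigr do rewrite mxE exprMn.
by rewrite -mulr_sumr sqrtrM ?sqr_ge0 // sqrtr_sqr.
Qed.

Lemma enorm_eq0 A : (enorm A == 0) = (A == 0).
Proof.
apply/eqP/eqP => [|->]; last first.
  by rewrite enormE big1 ?sqrtr0 // => p _; rewrite mxE expr0n.
move=> /eqP; rewrite enormE sqrtr_eq0 => s0.
have : \sum_(p : 'I_n * 'I_d) A p.1 p.2 ^+ 2 == 0.
  by rewrite eq_le s0 sumr_ge0 // => p _; exact: sqr_ge0.
rewrite psumr_eq0 => [/allP h|p _]; last exact: sqr_ge0.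
apply/matrixP => i j; rewrite mxE; apply/eqP; rewrite -sqrf_eq0.
by apply: (h (i, j)); rewrite mem_index_enum.
Qed.

Lemma enorm_delta i j : enorm (delta_mx i j : 'M[R]_(n, d)) = 1.
Proof.
rewrite enormE (bigD1 (i, j)) //= mxE !eqxx expr1n big1 ?addr0 ?sqrtr1 //.
move=> [k l]; rewrite xpair_eqE mxE /= => /negPf ->; by rewrite expr0n.
Qed.

Variable T : btree.
Local Notation X := (preshape R d n T).
Implicit Types x y : X.

(** What the argument needs from both norms: [norm_coord] lets small distances control every
    attribute, and [norm_transport] makes identifications isometric. *)
Record shape_norm (N : X -> R) : Prop := ShapeNorm {
  normD : forall x y, N (x + y) <= N x + N y;
  normZ : forall a x, N (a *: x) = `|a| * N x;
  norm_coord : forall x e, enorm (x e) <= N x;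
  norm_transport : forall (E : {set edge T}) s x, {in E &, injective s} ->
    supp x \subset s @: E -> N (transport E s x) = N x }.

Definition norm1 x := \sum_e enorm (x e).
Definition norm2 x := Num.sqrt (\sum_e enorm (x e) ^+ 2).

Lemma dist1E x y : dist1 x y = norm1 (x - y).
Proof. by apply: eq_bigr => e _; rewrite !ffunE. Qed.

Lemma dist2E x y : dist2 x y = norm2 (x - y).
Proof. by congr Num.sqrt; apply: eq_bigr => e _; rewrite !ffunE. Qed.

Lemma sum_transport (f : 'M[R]_(n, d) -> R) (E : {set edge T}) s x :
  f 0 = 0 -> {in E &, injective s} -> supp x \subset s @: E ->
  \sum_e f (transport E s x e) = \sum_e f (x e).
Proof.
move=> f0 sI /subset_suppP xE.
rewrite [RHS](bigID (mem (s @: E))) /= [X in _ + X]big1 ?addr0; last first.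
  by move=> e /xE ->.
rewrite big_imset //= [LHS](bigID (mem E)) /= [X in _ + X]big1 ?addr0; last first.
  by move=> e /negPf eE; rewrite ffunE eE.
by apply: eq_bigr => e eE; rewrite ffunE eE.
Qed.

Lemma enorm0 : enorm (0 : 'M[R]_(n, d)) = 0.
Proof. by apply/eqP; rewrite enorm_eq0. Qed.

Lemma shape_norm1 : shape_norm norm1.
Proof.
split.
- move=> x y; rewrite -big_split /=; apply: ler_sum => e _; rewrite ffunE; exact: ler_enormD.
- by move=> a x; rewrite /norm1 mulr_sumr; apply: eq_bigr => e _; rewrite ffunE enormZ.
- move=> x e; rewrite /norm1 (bigD1 e) //= lerDl sumr_ge0 // => *; exact: enorm_ge0.
- by move=> E s x; apply: sum_transport; exact: enorm0.
Qed.

Lemma shape_norm2 : shape_norm norm2.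
Proof.
split.
- move=> x y; apply: le_trans (sqrt_sum_sqrD _ _); rewrite ler_wsqrtr //.
  apply: ler_sum => e _; rewrite ffunE ler_sqr ?nnegrE ?ler_enormD ?addr_ge0 ?enorm_ge0 //.
- move=> a x; rewrite /norm2; under eq_bigr do rewrite ffunE enormZ exprMn.
  by rewrite -mulr_sumr sqrtrM ?sqr_ge0 // sqrtr_sqr normr_id.
- move=> x e; rewrite /norm2 -[leLHS]ger0_norm ?enorm_ge0 // -sqrtr_sqr ler_wsqrtr //.
  by rewrite (bigD1 e) //= lerDl sumr_ge0 // => *; exact: sqr_ge0.
- move=> E s x sI xE; rewrite /norm2; congr Num.sqrt.
  by rewrite (sum_transport (f := fun v => enorm v ^+ 2)) // enorm0 expr0n.
Qed.

End Norms.

(** * The chain metric *)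

Lemma seq_pos_lb (R : realType) (s : seq R) :
  exists2 eta : R, 0 < eta & forall a, a \in s -> 0 < a -> eta <= a.
Proof.
elim: s => [|b s [eta e0 es]]; first by exists 1.
exists (if 0 < b then Num.min eta b else eta).
  by case: ifP => // b0; rewrite lt_min e0 b0.
move=> a; rewrite inE => /predU1P[->|/es h] a0.
  by rewrite a0 ge_min lexx orbT.
by case: ifP => b0; rewrite ?ge_min h.
Qed.

Section Chain.
Variables (R : realType) (d n : nat) (T : btree).
Local Notation X := (preshape R d n T).
Variables (N : X -> R) (hN : shape_norm N).
Implicit Types (x y z u v w c : X) (a l : R).

Lemma norm0 : N 0 = 0.
Proof. by rewrite -(scale0r (0 : X)) (normZ hN) normr0 mul0r. Qed.

Lemma normN x : N (- x) = N x.
Proof. by rewrite -scaleN1r (normZ hN) normrN1 mul1r. Qed.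

Lemma norm_ge0 x : 0 <= N x.
Proof.
have := normD hN x (- x); rewrite subrr norm0 normN; lra.
Qed.

Lemma norm_distC x y : N (x - y) = N (y - x).
Proof. by rewrite -normN opprB. Qed.

Lemma norm_distD y x z : N (x - z) <= N (x - y) + N (y - z).
Proof. by rewrite (le_trans _ (normD hN _ _)) // addrA subrK. Qed.

Lemma supp0 : supp (0 : X) = finset.set0.
Proof. by apply/setP => e; rewrite !finset.inE ffunE eqxx. Qed.

Lemma suppD_sub x y (E : {set edge T}) :
  supp x \subset E -> supp y \subset E -> supp (x + y) \subset E.
Proof.
move=> /subset_suppP xE /subset_suppP yE; apply/subset_suppP => e eE.
by rewrite ffunE xE // yE // addr0.
Qed.

Lemma suppZ_sub a x (E : {set edge T}) : supp x \subset E -> supp (a *: x) \subset E.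
Proof.
by move=> /subset_suppP xE; apply/subset_suppP => e eE; rewrite ffunE xE // scaler0.
Qed.

Lemma suppB_sub x y (E : {set edge T}) :
  supp x \subset E -> supp y \subset E -> supp (x - y) \subset E.
Proof. by rewrite -scaleN1r => xE yE; rewrite suppD_sub ?suppZ_sub. Qed.

Lemma supp_homothety c z a (E : {set edge T}) :
  supp c \subset E -> supp z \subset E -> supp (c + a *: (z - c)) \subset E.
Proof. by move=> cE zE; rewrite suppD_sub ?suppZ_sub ?suppB_sub. Qed.

(** The map is [transport] along the preorder matching. The last clause shows that equivalent shapes
    take their attributes from one finite set. *)
Lemma collapse_isometryP x y : collapse x = collapse y ->
  exists P : X -> X, [/\ forall a u v, P (a *: u + v) = a *: P u + P v,
    P x = y,
    forall u, supp (P u) \subset supp y,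
    forall w, supp w \subset supp x -> collapse (P w) = collapse w /\ N (P w) = N w &
    forall u e, P u e = 0 \/ exists e', P u e = u e'].
Proof.
move=> /collapse_transportP[s [sI sE sx sc]]; exists (transport (supp y) s); split => //.
- move=> a u v; apply/ffunP => e; rewrite !ffunE.
  by case: ifP => // _; rewrite ?scaler0 ?addr0.
- by move=> u; apply/subset_suppP => e /negPf ey; rewrite ffunE ey.
- move=> w ws; split; first exact: sc.
  by rewrite (norm_transport hN) // sE.
- by move=> u e; rewrite ffunE; case: ifP; [right; exists (s e)|left].
Qed.

(** Both clauses hold below the smallest distance between two of the finitely
    many values taken by the edge attributes of the shapes collapsing to the
    same tree as [x0]. *)
Definition separating (x0 : X) (eta : R) : Prop :=
  forall c, collapse c = collapse x0 ->
    (forall z, N (z - c) < eta -> supp c \subset supp z) /\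
    (forall z c', collapse c' = collapse x0 ->
       N (z - c) < eta -> N (z - c') < eta -> c = c').

Lemma separatingP x0 : exists2 eta, 0 < eta & separating x0 eta.
Proof.
pose V : seq 'M[R]_(n, d) := 0 :: [seq x0 e | e <- enum (edge T)].
have [eta e0 etaP] := seq_pos_lb [seq enorm (p.1 - p.2) | p <- [seq (A, B) | A <- V, B <- V]].
(* [eta] is at most every positive gap between values in [V]; comparing two representatives near the
   same [z] adds two distances, hence the half. *)
exists (eta / 2); first by lra.
have valV c e : collapse c = collapse x0 -> c e \in V.
  move=> /esym/collapse_isometryP[P [_ <- _ _ /(_ x0 e)[->|[e' ->]]]].
    by rewrite inE eqxx.
  by rewrite inE map_f ?orbT // mem_enum.
have sep (A B : 'M[R]_(n, d)) : A \in V -> B \in V -> enorm (A - B) < eta -> A = B.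
  move=> AV BV lt; apply: contraTeq lt => AB; rewrite -leNgt; apply: etaP.
    by apply/mapP; exists (A, B) => //; apply/allpairsP; exists (A, B).
  by rewrite lt_def enorm_ge0 enorm_eq0 subr_eq0 AB.
move=> c cx; split=> [z zc|z c' c'x zc zc'].
  apply/fintype.subsetP => e; rewrite !finset.inE; apply: contraNneq => ze.
  apply/eqP; apply: sep; rewrite ?valV ?inE ?eqxx //.
  have := norm_coord hN (z - c) e; rewrite !ffunE ze sub0r subr0.
  by rewrite -scaleN1r enormZ normrN1 mul1r; lra.
apply/ffunP => e; apply: sep; rewrite ?valV //.
have := norm_coord hN (c - c') e; rewrite !ffunE.
have := norm_distD z c c'; rewrite (norm_distC c z); lra.
Qed.

Variable F : {set {set edge T}}.
Hypothesis F0 : F != finset.set0.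

(** The straight segment between two such points stays in one coordinate subspace of the restricted
    space. *)
Definition joinable x y := exists2 E, E \in F & supp x \subset E /\ supp y \subset E.
Local Notation inZ := (restricted_preshape R d n F).

Lemma inZP x : inZ x <-> exists2 E, E \in F & supp x \subset E.
Proof.
by split=> -[E EF] xE; exists E => //; apply/subset_suppP.
Qed.

Lemma inZ_supp x y : supp y \subset supp x -> inZ x -> inZ y.
Proof.
by move=> yx /inZP[E EF xE]; apply/inZP; exists E => //; exact: fintype.subset_trans xE.
Qed.

Lemma inZ0 : inZ (0 : X).
Proof.
by have /set0Pn[E EF] := F0; apply/inZP; exists E => //; rewrite supp0 finset.sub0set.
Qed.

Lemma joinableC x y : joinable x y -> joinable y x.
Proof. by move=> [E EF [xE yE]]; exists E. Qed.

Lemma joinable_inZ x y : joinable x y -> inZ y.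
Proof. by move=> [E EF [xE yE]]; apply/inZP; exists E. Qed.

Lemma joinable_sub x y : supp y \subset supp x -> inZ x -> joinable x y.
Proof.
by move=> yx /inZP[E EF xE]; exists E => //; split=> //; exact: fintype.subset_trans xE.
Qed.

(** Composite of identifications, of cost [0], and of straight moves inside
    the coordinate subspaces whose union is the restricted space. *)
Inductive chain x : X -> R -> Prop :=
| chain_nil : chain x x 0
| chain_eqv y z l : chain x y l -> inZ z -> collapse y = collapse z -> chain x z l
| chain_move y z l : chain x y l -> joinable y z -> chain x z (l + N (y - z)).

Lemma chain_ge0 x y l : chain x y l -> 0 <= l.
Proof. by elim=> // y' z l' _ l0 _; rewrite addr_ge0 // norm_ge0. Qed.

Lemma chain_inZ x y l : chain x y l -> inZ x -> inZ y.
Proof. by elim=> // y' z l' _ _ /joinable_inZ. Qed.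

Lemma chain_trans x y z l l' : chain x y l -> chain y z l' -> chain x z (l + l').
Proof.
move=> xy; elim=> [|u v k _ c vZ uv|u v k _ c uv]; rewrite ?addr0 //.
  exact: chain_eqv uv.
by rewrite addrA; exact: chain_move.
Qed.

Lemma chain1 x y : joinable x y -> chain x y (N (x - y)).
Proof. by move=> xy; rewrite -[N _]add0r; apply: chain_move => //; exact: chain_nil. Qed.

Lemma chain_sym x y l : inZ x -> chain x y l -> chain y x l.
Proof.
move=> xZ; elim=> [|u v k xu c vZ uv|u v k xu c uv]; first exact: chain_nil.
  rewrite -[k]add0r; apply: chain_trans c.
  by apply: (chain_eqv (chain_nil v)) => //; exact: chain_inZ xu xZ.
rewrite addrC; apply: chain_trans c; rewrite norm_distC; apply: chain1.
exact: joinableC.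
Qed.

Definition chain_dist x y : R := inf [set l | chain x y l].

(** A union of linear subspaces is star-shaped about the origin. *)
Lemma chain_exists x y : inZ x -> inZ y -> exists l, chain x y l.
Proof.
move=> xZ yZ; exists (N (x - 0) + N (0 - y)); apply: chain_trans; apply: chain1.
  by apply: joinable_sub; rewrite ?supp0 ?finset.sub0set.
by apply: joinableC; apply: joinable_sub; rewrite ?supp0 ?finset.sub0set.
Qed.

Lemma chain_has_lb x y : has_lbound [set l | chain x y l].
Proof. by exists 0 => l /chain_ge0. Qed.

Lemma chain_dist_le x y l : chain x y l -> chain_dist x y <= l.
Proof. by move=> xy; apply: ge_inf => //; exact: chain_has_lb. Qed.

Lemma chain_dist_ge0 x y : 0 <= chain_dist x y.
Proof.
rewrite /chain_dist; have [->|/set0P ne] := eqVneq [set l | chain x y l] set0.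
  by rewrite inf0.
by apply: lb_le_inf => // l /chain_ge0.
Qed.

Lemma chain_dist_lt x y a : inZ x -> inZ y -> chain_dist x y < a ->
  exists2 l, l < a & chain x y l.
Proof.
move=> xZ yZ xya; have [l xyl] := chain_exists xZ yZ.
have [|l' xyl' la] := @inf_lt R [set l | chain x y l] a _ xya; last by exists l'.
by exists l.
Qed.

Lemma chain_dist_glb x y a : inZ x -> inZ y ->
  (forall l, chain x y l -> a <= l) -> a <= chain_dist x y.
Proof.
move=> xZ yZ h; apply: lb_le_inf => //; exact: chain_exists.
Qed.

Lemma chain_distD y x z : inZ x -> inZ y -> inZ z ->
  chain_dist x z <= chain_dist x y + chain_dist y z.
Proof.
move=> xZ yZ zZ; apply/ler_addgt0Pr => e e0.
have [l ll xyl] := @chain_dist_lt x y (chain_dist x y + e / 2) xZ yZ ltac:(lra).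
have [l' ll' yzl] := @chain_dist_lt y z (chain_dist y z + e / 2) yZ zZ ltac:(lra).
have := chain_dist_le (chain_trans xyl yzl); lra.
Qed.

Lemma chain_distC x y : inZ x -> inZ y -> chain_dist x y = chain_dist y x.
Proof.
by move=> xZ yZ; apply/eqP; rewrite eq_le; apply/andP; split;
  apply: chain_dist_glb => // l xy; apply: chain_dist_le; exact: chain_sym.
Qed.

Lemma chain_dist_eqv x y : inZ y -> collapse x = collapse y -> chain_dist x y = 0.
Proof.
move=> yZ xy; apply/eqP; rewrite eq_le chain_dist_ge0 andbT.
by apply: chain_dist_le; apply: chain_eqv xy => //; exact: chain_nil.
Qed.

Lemma chain_dist_joinable x y : joinable x y -> chain_dist x y <= N (x - y).
Proof. by move=> xy; apply: chain_dist_le; exact: chain1. Qed.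

Lemma chain_dist_eqv2 x x' y y' : inZ x -> inZ x' -> inZ y -> inZ y' ->
  collapse x = collapse x' -> collapse y = collapse y' ->
  chain_dist x y = chain_dist x' y'.
Proof.
have le x1 x2 y1 y2 : inZ x1 -> inZ x2 -> inZ y1 -> inZ y2 ->
    collapse x1 = collapse x2 -> collapse y1 = collapse y2 ->
    chain_dist x1 y1 <= chain_dist x2 y2.
  move=> x1Z x2Z y1Z y2Z x12 y12.
  have := chain_distD x1Z x2Z y1Z; have := chain_distD x2Z y2Z y1Z.
  by rewrite (@chain_dist_eqv x1 x2) // (@chain_dist_eqv y2 y1) //; lra.
by move=> *; apply/eqP; rewrite eq_le !le.
Qed.

(** * Local structure of the chain metric *)

(** The representative [c] travels with the chain: an identification carries it along by the linear
    isometry, and a move leaves it fixed, since closeness keeps its support inside the subspace of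
    the move. Homotheties about these centres scale every step. *)
Lemma chain_homothety x0 eta c u w l a : separating x0 eta -> inZ u ->
  collapse c = collapse x0 -> chain u w l -> N (u - c) + l < eta ->
  exists c', [/\ collapse c' = collapse x0, N (w - c') <= N (u - c) + l &
    chain (c + a *: (u - c)) (c' + a *: (w - c')) (`|a| * l)].
Proof.
move=> sep uZ cx0.
elim=> [|y z k uy IH zZ yz|y z k uy IH [E EF [yE zE]]] lt.
- by exists c; split=> //; rewrite ?addr0 // mulr0; exact: chain_nil.
- have [c' [c'x0 yc' ch]] := IH lt.
  have c'y : supp c' \subset supp y by apply: (sep c' c'x0).1; exact: le_lt_trans lt.
  have [P [PL Py Pz Pc _]] := collapse_isometryP yz.
  have PB u1 u2 : P (u1 - u2) = P u1 - P u2.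
    by rewrite addrC -scaleN1r PL scaleN1r addrC.
  exists (P c'); split.
  + by rewrite (Pc _ c'y).1.
  + by rewrite -Py -PB (Pc _ _).2 // suppB_sub.
  + have -> : P c' + a *: (z - P c') = P (c' + a *: (y - c')).
      by rewrite addrC -Py -PB -PL addrC.
    apply: chain_eqv ch _ _; last by rewrite (Pc _ _).1 // supp_homothety.
    by apply: inZ_supp zZ.
- have Nyz := norm_ge0 (y - z).
  have [|c' [c'x0 yc' ch]] := IH; first by lra.
  have c'y : supp c' \subset supp y by apply: (sep c' c'x0).1; lra.
  exists c'; split=> //.
    by have := norm_distD y z c'; rewrite (norm_distC z y); lra.
  have -> : `|a| * (k + N (y - z)) =
     `|a| * k + N (c' + a *: (y - c') - (c' + a *: (z - c'))).
    rewrite mulrDr -(normZ hN); congr (_ + N _).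
    by rewrite opprD addrACA subrr add0r -scalerBr opprB addrA subrK.
  apply: chain_move ch _; exists E => //.
  have c'E := fintype.subset_trans c'y yE.
  by split; apply: supp_homothety.
Qed.

(** [D a] is the homothety of ratio [a] towards the nearest shape collapsing to
    the same tree as [x0]. *)
Lemma chain_dilation x0 : inZ x0 ->
  exists r (D : R -> X -> X), 0 < r /\ forall a, 0 < a -> a <= 1 ->
    D a x0 = x0 /\
    (forall u, inZ u -> chain_dist x0 u < r -> inZ (D a u)) /\
    (forall u w, inZ u -> inZ w -> chain_dist x0 u < r -> chain_dist x0 w < r ->
       chain_dist (D a u) (D a w) = a * chain_dist u w).
Proof.
move=> x0Z; have [eta e0 sep] := separatingP x0.
pose near u c := [/\ collapse c = collapse x0, supp c \subset supp u & N (u - c) < eta / 4].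
(* Near [x0] this is a representative of [x0] close to [u]; where none exists it is [0]. *)
pose C u := xget 0 (near u).
have nearC u : inZ u -> chain_dist x0 u < eta / 4 -> near u (C u).
  move=> uZ ux0; have [l l4 ch] := chain_dist_lt x0Z uZ ux0.
  have [|c [cx0 uc _]] := @chain_homothety x0 eta x0 x0 u l 1 sep x0Z erefl ch.
    by rewrite subrr norm0; lra.
  rewrite subrr norm0 add0r in uc.
  apply: (@xgetPex _ 0 (near u)); exists c; split=> //; last by lra.
  by apply: (sep c cx0).1; lra.
exists (eta / 4), (fun a u => C u + a *: (u - C u)); split; first by lra.
move=> a a0 a1.
have distDa u w : inZ u -> inZ w -> chain_dist x0 u < eta / 4 -> chain_dist x0 w < eta / 4 ->
    chain_dist (C u + a *: (u - C u)) (C w + a *: (w - C w)) <= a * chain_dist u w.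
  move=> uZ wZ ux wx; have [cux cus cu] := nearC u uZ ux; have [cwx cws cw] := nearC w wZ wx.
  rewrite -ler_pdivrMl //; apply/ler_addgt0Pr => e ep.
  have uw2 : chain_dist u w < eta / 2.
    have := chain_distD uZ x0Z wZ; rewrite (chain_distC uZ x0Z); lra.
  have [|l lm ch] := @chain_dist_lt u w (Num.min (eta / 2) (chain_dist u w + e)) uZ wZ.
    by rewrite lt_min uw2 /=; lra.
  move: lm; rewrite lt_min => /andP[l2 le].
  (* A chain of length below [eta / 2] that starts within [eta / 4] of its centre stays within [eta]
     of it, so the centre carried to [w] must be [C w]. *)
  have [|c' [c'x wc' ch']] := chain_homothety a sep uZ cux ch; first by lra.
  have cE : c' = C w by apply: ((sep c' c'x).2 w) => //; lra.
  rewrite cE (gtr0_norm a0) in ch'.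
  by rewrite ler_pdivrMl // (le_trans (chain_dist_le ch')) // ler_pM2l //; lra.
split; last split.
- have [cx _ cc] := nearC x0 x0Z ltac:(rewrite chain_dist_eqv //; lra).
  suff -> : C x0 = x0 by rewrite subrr scaler0 addr0.
  by apply: ((sep _ cx).2 x0) => //; rewrite ?subrr ?norm0; lra.
- move=> u uZ ux; have [_ cu _] := nearC u uZ ux.
  by apply: inZ_supp uZ; apply: supp_homothety.
- move=> u w uZ wZ ux wx; apply/eqP; rewrite eq_le distDa //=.
  have [cux cus cu] := nearC u uZ ux; have [cwx cws cw] := nearC w wZ wx.
  set u' := C u + _; set w' := C w + _.
  have u'Z : inZ u' by apply: inZ_supp uZ; apply: supp_homothety.
  have w'Z : inZ w' by apply: inZ_supp wZ; apply: supp_homothety.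
  have shrink (z c : X) : N (c + a *: (z - c) - c) = a * N (z - c).
    by rewrite addrAC subrr add0r (normZ hN) gtr0_norm.
  have expand (z c : X) : c + a^-1 *: (c + a *: (z - c) - c) = z.
    by rewrite [c + _ *: _ - c]addrAC subrr add0r scalerA mulVf ?gt_eqF // scale1r addrC subrK.
  have uw2 : chain_dist u w < eta / 2.
    have := chain_distD uZ x0Z wZ; rewrite (chain_distC uZ x0Z); lra.
  have small (k : R) : 0 <= k -> k < eta / 4 -> a * k < eta / 4.
    by move=> k0 k4; apply: le_lt_trans k4; rewrite ler_piMl.
  apply/ler_addgt0Pr => e ep.
  have dl : chain_dist u' w' < eta / 2.
    apply: le_lt_trans (distDa u w uZ wZ ux wx) _; apply: le_lt_trans uw2.
    by rewrite ler_piMl // chain_dist_ge0.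
  have [|l lm ch] := @chain_dist_lt u' w' (Num.min (eta / 2) (chain_dist u' w' + e)) u'Z w'Z.
    by rewrite lt_min dl /=; lra.
  move: lm; rewrite lt_min => /andP[l2 le].
  have Nu' : N (u' - C u) < eta / 4 by rewrite shrink small ?norm_ge0.
  have Nw' : N (w' - C w) < eta / 4 by rewrite shrink small ?norm_ge0.
  (* For the reverse inequality the homothety of ratio [a^-1] takes a short chain between the images
     back to [u] and [w]. *)
  have [|c' [c'x wc' ch']] := chain_homothety a^-1 sep u'Z cux ch; first by lra.
  have cE : c' = C w by apply: ((sep c' c'x).2 w') => //; lra.
  rewrite cE !expand (gtr0_norm) ?invr_gt0 // in ch'.
  have := chain_dist_le ch'; rewrite ler_pdivlMl //; lra.
Qed.

(** For [x] in the restricted space, the support of each allowed representative is maximal in [F]: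
    none can gain an edge. *)
Definition generic x := forall y E, inZ y -> collapse y = collapse x -> E \in F ->
  supp y \subset E -> E \subset supp y.

(** Near a generic shape every allowed point has exactly the support of the representative it is
    close to. Short chains can therefore be lifted step by step to the single coordinate subspace of
    [x0], where the norm bounds their length from below. *)
Lemma generic_chart x0 : inZ x0 -> generic x0 -> exists2 r, 0 < r &
  (forall u v, supp u \subset supp x0 -> supp v \subset supp x0 ->
     N (u - x0) < r -> N (v - x0) < r -> chain_dist u v = N (u - v)) /\
  (forall z, inZ z -> chain_dist x0 z < r ->
     exists u, [/\ supp u \subset supp x0, collapse u = collapse z & N (u - x0) < r]).
Proof.
move=> x0Z gx0; have [eta e0 sep] := separatingP x0.
have near_supp c z : inZ z -> collapse c = collapse x0 -> N (z - c) < eta -> supp z = supp c.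
  move=> zZ cx zc; have cz := (sep c cx).1 z zc.
  have [E EF zE] := (inZP z).1 zZ.
  apply/eqP; rewrite finset.eqEsubset cz andbT (fintype.subset_trans zE) //.
  apply: gx0 => //; last exact: fintype.subset_trans zE.
  exact: inZ_supp cz zZ.
have subZ u : supp u \subset supp x0 -> inZ u by move=> us; exact: inZ_supp x0Z.
have lift u w l : supp u \subset supp x0 -> N (u - x0) < eta / 2 -> chain u w l ->
    l < eta / 2 -> exists w', [/\ supp w' \subset supp x0, collapse w' = collapse w &
      N (u - w') <= l].
  move=> us ux; elim=> [|y z k uy IH zZ yz|y z k uy IH yz] lt.
  - by exists u; rewrite subrr norm0.
  - by have [y' [sy' cy' ly']] := IH lt; exists y'; rewrite -yz.
  - have Nyz := norm_ge0 (y - z).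
    have [|y' [sy' cy' ly']] := IH; first by lra.
    have y'x : N (y' - x0) < eta / 2 + k.
      by have := norm_distD u y' x0; rewrite (norm_distC y' u); lra.
    have sy'E : supp y' = supp x0 by apply: near_supp => //; [exact: subZ|lra].
    have yZ : inZ y by exact: chain_inZ uy (subZ _ us).
    have [P [PL Py Ps Pc _]] := collapse_isometryP cy'.
    have PB u1 u2 : P (u1 - u2) = P u1 - P u2.
      by rewrite addrC -scaleN1r PL scaleN1r addrC.
    (* The isometry from the lifted point [y'] to [y] carries [x0] to a representative [c] near both
       [y] and [z]. *)
    pose c := P x0.
    have cx : collapse c = collapse x0 by rewrite (Pc _ _).1 // sy'E.
    have yc : N (y - c) = N (y' - x0).
      by rewrite -Py -PB (Pc _ _).2 // suppB_sub // sy'E.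
    have zc : N (z - c) < eta.
      by have := norm_distD y z c; rewrite (norm_distC z y); lra.
    have sz : supp z = supp c by apply: near_supp => //; exact: joinable_inZ yz.
    have sy : supp y = supp c by apply: near_supp => //; lra.
    have [Q [QL Qc Qs QP _]] := collapse_isometryP cx.
    have QB u1 u2 : Q (u1 - u2) = Q u1 - Q u2.
      by rewrite addrC -scaleN1r QL scaleN1r addrC.
    (* Equal collapse and equal support force equality, so [Q] maps the move from [y] to [z]
       isometrically to one starting at [y']. *)
    have Qy : Q y = y'.
      apply: collapse_inj_supp; first by rewrite (QP _ _).1 ?sy.
      rewrite sy'E; apply: near_supp => //; first exact: subZ.
      by rewrite -Qc -QB (QP _ _).2 ?suppB_sub ?sy // yc; lra.
    exists (Q z); split=> //; first by rewrite (QP _ _).1 ?sz.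
    have := norm_distD y' u (Q z); rewrite -Qy -QB (QP _ _).2 ?suppB_sub ?sy ?sz // Qy.
    lra.
exists (eta / 4); first by lra.
split=> [u v us vs ux vx|z zZ zx].
  have jn : joinable u v.
    by have [E EF xE] := (inZP x0).1 x0Z; exists E => //; split;
      apply: fintype.subset_trans xE.
  apply/eqP; rewrite eq_le chain_dist_joinable //=.
  apply: chain_dist_glb; try exact: subZ.
  (* Chains of length at least [eta / 2] already exceed [N (u - v)]. *)
  move=> l ch; have [l2|] := ltP l (eta / 2); last first.
    by have := norm_distD x0 u v; rewrite (norm_distC x0 v); lra.
  have [|v' [v's v'v uv']] := lift u v l us _ ch l2; first by lra.
  suff <- : v' = v by [].
  apply: collapse_inj_supp => //.
  rewrite (near_supp x0 v) //; [|exact: subZ|lra].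
  apply: near_supp => //; first exact: subZ.
  by have := norm_distD u v' x0; rewrite (norm_distC v' u); lra.
have [l l4 ch] := chain_dist_lt x0Z zZ zx.
have [|||w [ws wz xw]] := lift x0 z l _ _ ch; rewrite ?subrr ?norm0 //; try lra.
by exists w; split=> //; rewrite norm_distC; lra.
Qed.

End Chain.

(** * Comparison triangles *)

Section Models.
Variable R : realType.
Implicit Types (k s a b c t x y D L : R) (u v p q r m : 'rV[R]_3).

(** Stewart's relation in a surface of constant curvature, for a point at
    distance [D] from a vertex that divides the opposite side into [t] and
    [a]; [c] and [b] are the two other sides and [sn] is the sine of the
    geometry.  Its limit at small scale is the Euclidean relation. *)
Definition small_stewart (sn : R -> R) a t b c D : Prop :=
  sn (a + t) * sn (D / 2) ^+ 2 + sn a * sn (t / 2) ^+ 2 + sn t * sn (a / 2) ^+ 2 <=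
  sn a * sn (c / 2) ^+ 2 + sn t * sn (b / 2) ^+ 2.

Let form s u v := u 0 0 * v 0 0 + s * (u 0 1 * v 0 1 + u 0 2 * v 0 2).

(** The combination [w] of [m], [q] and [r] is orthogonal to all three, hence to itself, and
    vanishes. Pairing it with [p] expresses [form s p m] by the sides, and half-angle identities
    turn cosines into squared sines. *)
Lemma quadric_stewart s (sn cs : R -> R) p q r m a t b c D :
  s = 1 \/ s = -1 ->
  (forall x y, sn (x + y) = sn x * cs y + cs x * sn y) ->
  (forall x y, cs (x + y) = cs x * cs y - s * (sn x * sn y)) ->
  (forall x, cs x ^+ 2 + s * sn x ^+ 2 = 1) ->
  (forall x, cs x = 1 - 2 * s * sn (x / 2) ^+ 2) ->
  form s p p = 1 -> form s q q = 1 -> form s r r = 1 -> form s m m = 1 ->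
  form s p q = cs c -> form s r p = cs b -> form s q r = cs (a + t) ->
  form s q m = cs t -> form s m r = cs a ->
  0 <= sn (a + t) -> 0 <= s * (cs D - form s p m) ->
  small_stewart sn a t b c D.
Proof.
move=> hs snD csD cs2 csE pp qq rr mm pq rp qr qm mr snat csD0.
pose w (i : 'I_3) := sn (a + t) * m 0 i - sn a * q 0 i - sn t * r 0 i.
have wE v : w 0 * v 0 0 + s * (w 1 * v 0 1 + w 2 * v 0 2) =
    sn (a + t) * form s v m - sn a * form s v q - sn t * form s v r.
  by rewrite /form /w; ring.
have formC u v : form s u v = form s v u by rewrite /form; ring.
have csa := cs2 a; have cst := cs2 t.
have wq : w 0 * q 0 0 + s * (w 1 * q 0 1 + w 2 * q 0 2) = 0.
  rewrite wE qm qq qr snD csD.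
  transitivity (sn a * (cs t ^+ 2 + s * sn t ^+ 2 - 1)); first by ring.
  by rewrite cst subrr mulr0.
have wr : w 0 * r 0 0 + s * (w 1 * r 0 1 + w 2 * r 0 2) = 0.
  rewrite wE (formC r m) (formC r q) rr mr qr snD csD.
  transitivity (sn t * (cs a ^+ 2 + s * sn a ^+ 2 - 1)); first by ring.
  by rewrite csa subrr mulr0.
have wm : w 0 * m 0 0 + s * (w 1 * m 0 1 + w 2 * m 0 2) = 0.
  rewrite wE mm (formC m q) qm mr snD; ring.
have ww : w 0 ^+ 2 + s * (w 1 ^+ 2 + w 2 ^+ 2) = 0.
  transitivity (sn (a + t) * (w 0 * m 0 0 + s * (w 1 * m 0 1 + w 2 * m 0 2))
    - sn a * (w 0 * q 0 0 + s * (w 1 * q 0 1 + w 2 * q 0 2))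
    - sn t * (w 0 * r 0 0 + s * (w 1 * r 0 1 + w 2 * r 0 2))); first by rewrite /w; ring.
  by rewrite wq wr wm !mulr0 !subr0.
have [w0 w1 w2] : [/\ w 0 = 0, w 1 = 0 & w 2 = 0].
  have sq0 x : x ^+ 2 <= 0 -> x = 0.
    by move=> x2; apply/eqP; rewrite -sqrf_eq0 eq_le x2 sqr_ge0.
  have g0 := sqr_ge0 (w 0); have g1 := sqr_ge0 (w 1); have g2 := sqr_ge0 (w 2).
  case: hs => hs; rewrite hs in ww wq qq.
    by split; apply: sq0; lra.
  (* [w] is isotropic and orthogonal to the timelike vector [q] *)
  have W0 : w 0 ^+ 2 <= 0.
    have E1 : (w 0 * q 0 0) ^+ 2 = (w 1 * q 0 1 + w 2 * q 0 2) ^+ 2.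
      by congr (_ ^+ 2); lra.
    have E2 : (w 1 * q 0 1 + w 2 * q 0 2) ^+ 2 + (w 1 * q 0 2 - w 2 * q 0 1) ^+ 2 =
       (w 1 ^+ 2 + w 2 ^+ 2) * (q 0 1 ^+ 2 + q 0 2 ^+ 2) by ring.
    have E3 : w 1 ^+ 2 + w 2 ^+ 2 = w 0 ^+ 2 by lra.
    have E4 : q 0 1 ^+ 2 + q 0 2 ^+ 2 = q 0 0 ^+ 2 - 1.
      by rewrite /form in qq; lra.
    have E5 := sqr_ge0 (w 1 * q 0 2 - w 2 * q 0 1).
    rewrite E3 E4 -E1 exprMn mulrBr in E2; lra.
  by split; apply: sq0; lra.
have pm : sn (a + t) * form s p m = sn a * cs c + sn t * cs b.
  by have := wE p; rewrite w0 w1 w2 !mul0r pq (formC p r) rp; lra.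
rewrite /small_stewart.
have key := mulr_ge0 snat csD0.
have H1 : s * (sn (a + t) * cs D - (sn a * cs c + sn t * cs b)) >= 0.
  by rewrite -pm -mulrBr mulrCA.
have s2 : s * s = 1 by case: hs => ->; ring.
have E : s * (sn (a + t) * cs D - (sn a * cs c + sn t * cs b)) =
   2 * (s * s) * (sn a * sn (c / 2) ^+ 2 + sn t * sn (b / 2) ^+ 2 -
     (sn (a + t) * sn (D / 2) ^+ 2 + sn a * sn (t / 2) ^+ 2 + sn t * sn (a / 2) ^+ 2)).
  rewrite (csE D) (csE c) (csE b).
  have -> : sn (a + t) * (1 - 2 * s * sn (D / 2) ^+ 2) =
     sn a * cs t + cs a * sn t - 2 * s * (sn (a + t) * sn (D / 2) ^+ 2).
    by rewrite mulrBr mulr1 {1}snD; ring.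
  rewrite (csE a) (csE t); ring.
rewrite E s2 in H1; lra.
Qed.

(** By the chain rule: this is the difference quotient of [e |-> f (e * x)] at [0]. *)
Lemma derive_ratio (f : R -> R) x : f 0 = 0 -> is_derive (0 : R) 1 f 1 ->
  f (e * x) / e @[e --> (0 : R)^'+] --> x.
Proof.
move=> f0 df.
have d0 : is_derive (0 : R) 1 f 1 := df.
have dg : is_derive (0 : R) 1 (fun e : R => f (e * x)) x.
  have dx : is_derive (0 : R) 1 (fun e : R => e * x) x.
    by apply: is_derive_eq; rewrite ?scaler0 ?add0r //=; rewrite /GRing.scale /=; ring.
  have df' : is_derive (0 * x) 1 f 1 by rewrite mul0r.
  have := @is_derive1_comp R f (fun e => e * x) 0 1 x df' dx; by rewrite mul1r.
have [cg Dg] := dg.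
have : (fun h => h^-1 *: (f (h * x))) h @[h --> (0 : R)^'] --> x.
  rewrite -[X in _ --> X]Dg /derive /=.
  rewrite /derivable in cg.
  have -> : (fun h : R => h^-1 *: f (h * x)) =
    (fun h : R => h^-1 *: (((fun e : R => f (e * x)) \o shift 0) (h *: (1 : R)) - f (0 * x))).
    by apply/funext => h; rewrite /= addr0 mul0r f0 subr0 /GRing.scale /= mulr1.
  exact: cg.
move=> /cvg_dnbhs_at_right; apply: cvg_trans.
by apply: near_eq_cvg; near=> e; rewrite /GRing.scale /= [_^-1 * _]mulrC.
Unshelve. all: end_near. Qed.

Definition sinh x := (expR x - expR (- x)) / 2.
Definition cosh x := (expR x + expR (- x)) / 2.

Lemma is_derive_sinh0 : is_derive (0 : R) 1 sinh 1.
Proof.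
rewrite /sinh; apply: is_derive_eq.
by rewrite oppr0 expR0 /GRing.scale /=; field.
Qed.

Lemma cosh_sinh x : cosh x ^+ 2 - sinh x ^+ 2 = 1.
Proof.
by rewrite /cosh /sinh expRN; field; rewrite gt_eqF ?expR_gt0.
Qed.

Lemma cosh_arcosh y : 1 <= y -> 0 <= arcosh y /\ cosh (arcosh y) = y.
Proof.
move=> y1; rewrite /arcosh; set z := Num.sqrt _.
have z2 : z ^+ 2 = y ^+ 2 - 1.
  by rewrite sqr_sqrtr // subr_ge0 expr_ge1 //; lra.
have z0 : 0 <= z by exact: sqrtr_ge0.
split; first by rewrite ln_ge0 //; lra.
rewrite /cosh expRN lnK ?posrE; last by lra.
have yz : y + z != 0 by rewrite gt_eqF //; lra.
apply: (mulIf yz); rewrite -[RHS]mulrC.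
transitivity (((y + z) ^+ 2 + 1) / 2); first by field.
by rewrite sqrrD z2 mulr2n; field.
Qed.

Lemma cosh_le x y : 0 <= x -> x <= y -> cosh x <= cosh y.
Proof.
move=> x0 xy; rewrite /cosh ler_pM2r // !expRN.
have a1 : 1 <= expR x by rewrite -expR0 ler_expR.
have ab : expR x <= expR y by rewrite ler_expR.
set a := expR x in a1 ab *; set b := expR y in ab *.
have an : a != 0 by rewrite gt_eqF //; lra.
have bn : b != 0 by rewrite gt_eqF //; lra.
have ab1 : (a * b)^-1 <= 1.
  by rewrite invf_le1 ?mulr_gt0 ?mulr_ege1 //; lra.
have : 0 <= (b - a) * (1 - (a * b)^-1) by rewrite mulr_ge0 ?subr_ge0.
have -> : (b - a) * (1 - (a * b)^-1) = b + b^-1 - (a + a^-1) by field; apply/andP.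
by rewrite subr_ge0.
Qed.

Lemma model_formE k s u v : Num.sg k = s -> model_form k u v = form s u v.
Proof. by rewrite /model_form => ->. Qed.

Lemma form_sphere u v : form 1 u u = 1 -> form 1 v v = 1 -> -1 <= form 1 u v <= 1.
Proof.
rewrite /form => uu vv; apply/andP; split.
  have := sqr_ge0 (u 0 0 + v 0 0); have := sqr_ge0 (u 0 1 + v 0 1);
  have := sqr_ge0 (u 0 2 + v 0 2); lra.
have := sqr_ge0 (u 0 0 - v 0 0); have := sqr_ge0 (u 0 1 - v 0 1);
have := sqr_ge0 (u 0 2 - v 0 2); lra.
Qed.

(** The reversed Cauchy-Schwarz inequality on the upper sheet. *)
Lemma form_hyperbolic u v : form (-1) u u = 1 -> form (-1) v v = 1 ->
  0 < u 0 0 -> 0 < v 0 0 -> 1 <= form (-1) u v.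
Proof.
rewrite /form => uu vv u0 v0.
set x := u 0 1 * v 0 1 + u 0 2 * v 0 2.
have uv0 : 0 <= u 0 0 * v 0 0 by rewrite ltW // mulr_gt0.
suff : 1 + x <= u 0 0 * v 0 0 by lra.
have [neg|pos] := ltP (1 + x) 0; first by lra.
rewrite -ler_sqr ?nnegrE // -subr_ge0.
have E1 : u 0 0 ^+ 2 = 1 + u 0 1 ^+ 2 + u 0 2 ^+ 2 by lra.
have E2 : v 0 0 ^+ 2 = 1 + v 0 1 ^+ 2 + v 0 2 ^+ 2 by lra.
have -> : (u 0 0 * v 0 0) ^+ 2 - (1 + x) ^+ 2 = (u 0 1 - v 0 1) ^+ 2 +
   (u 0 2 - v 0 2) ^+ 2 + (u 0 1 * v 0 2 - u 0 2 * v 0 1) ^+ 2.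
  rewrite exprMn E1 E2 /x; ring.
by rewrite !addr_ge0 ?sqr_ge0.
Qed.

(** [sn] and [h] are [sinh] and the root of [- k], [sin] and the root of [k], or the identity and
    [1]. The bound by pi keeps the sine of the scaled opposite side nonnegative; the limit clause
    makes all three Euclidean at small scale. *)
Lemma model_stewart k : exists (sn : R -> R) (h : R), [/\ 0 < h,
  forall x, sn (e * x) / e @[e --> (0 : R)^'+] --> x &
  forall p q r m a t b c D, model_surface k p -> model_surface k q ->
    model_surface k r -> model_surface k m ->
    0 <= a -> 0 <= t -> 0 <= b -> 0 <= c -> 0 <= D -> (0 < k -> h * (a + t) <= trigo.pi) ->
    model_dist k p q = c -> model_dist k q r = a + t -> model_dist k r p = b ->
    model_dist k q m = t -> model_dist k m r = a -> D <= model_dist k p m ->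
    small_stewart sn (h * a) (h * t) (h * b) (h * c) (h * D)].
Proof.
have [k0|k0|k0] := ltgtP k 0.
- have hk : 0 < Num.sqrt (- k) by rewrite sqrtr_gt0; lra.
  exists sinh, (Num.sqrt (- k)); split => //.
    move=> x; apply: derive_ratio; last exact: is_derive_sinh0.
    by rewrite /sinh oppr0 subrr mul0r.
  move=> p q r m a t b c D [pp ps] [qq qs] [rr rs] [mm ms] a0 t0 b0 c0 D0 _.
  rewrite /model_surface /model_dist ltNge (ltW k0) /= k0.
  have sk : Num.sg k = -1 by apply/eqP; rewrite sgr_cp0.
  move: pp qq rr mm (ps (ltW k0)) (qs (ltW k0)) (rs (ltW k0)) (ms (ltW k0)).
  rewrite !(model_formE _ _ sk) => pp qq rr mm {}ps {}qs {}rs {}ms.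
  have dE u v x : form (-1) u u = 1 -> form (-1) v v = 1 -> 0 < u 0 0 -> 0 < v 0 0 ->
      arcosh (form (-1) u v) / Num.sqrt (- k) = x ->
      form (-1) u v = cosh (Num.sqrt (- k) * x).
    move=> uu vv u0 v0 <-; rewrite mulrC divfK ?gt_eqF //.
    by have [_ ->] := cosh_arcosh (form_hyperbolic uu vv u0 v0).
  move=> /dE pq /dE qr /dE rp /dE qm /dE mr.
  rewrite ler_pdivlMr // mulrC => Dpm.
  apply: (@quadric_stewart (-1) sinh cosh p q r m) => //; try (rewrite -?mulrDr; auto).
  + by move=> x y; rewrite /sinh /cosh opprD !expRD; field.
  + by move=> x y; rewrite /sinh /cosh opprD !expRD; field.
  + by move=> x; have := cosh_sinh x; lra.
  + move=> x; have {1}-> : x = x / 2 + x / 2 by field.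
    by rewrite /sinh /cosh opprD !expRD !expRN; field; rewrite gt_eqF ?expR_gt0.
  + by rewrite /sinh divr_ge0 // subr_ge0 ler_expR; have := mulr_ge0 (ltW hk) (addr_ge0 a0 t0); lra.
  + have [d0 {1}<-] := cosh_arcosh (form_hyperbolic pp mm ps ms).
    rewrite mulN1r opprB subr_ge0; apply: cosh_le => //.
    by rewrite mulr_ge0 // ltW.
- have hk : 0 < Num.sqrt k by rewrite sqrtr_gt0.
  exists sin, (Num.sqrt k); split => //.
    move=> x; apply: derive_ratio; first exact: sin0.
    by have := is_derive_sin (0 : R); rewrite cos0.
  move=> p q r m a t b c D [pp _] [qq _] [rr _] [mm _] a0 t0 b0 c0 D0 /(_ isT) lepi.
  rewrite /model_dist k0.
  have sk : Num.sg k = 1 by apply/eqP; rewrite sgr_cp0.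
  move: pp qq rr mm; rewrite !(model_formE _ _ sk) => pp qq rr mm.
  have dE u v x : form 1 u u = 1 -> form 1 v v = 1 ->
      acos (form 1 u v) / Num.sqrt k = x -> form 1 u v = cos (Num.sqrt k * x).
    move=> uu vv <-; rewrite mulrC divfK ?gt_eqF // acosK // in_itv /=.
    exact: form_sphere.
  move=> /dE pq /dE qr /dE rp /dE qm /dE mr.
  rewrite ler_pdivlMr // mulrC => Dpm.
  apply: (@quadric_stewart 1 sin cos p q r m) => //; try (rewrite -?mulrDr; auto).
  + by move=> x y; rewrite sinD; ring.
  + by move=> x y; rewrite cosD; ring.
  + by move=> x; rewrite mul1r cos2Dsin2.
  + move=> x; have {1}-> : x = x / 2 + x / 2 by field.
    by rewrite cosD; have := cos2Dsin2 (x / 2); lra.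
  + by rewrite sin_ge0_pi // lepi andbT mulr_ge0 ?addr_ge0 // ltW.
  + have pmb := form_sphere pp mm.
    rewrite mul1r subr_ge0 -[leLHS]acosK ?in_itv //=.
    have := acos_lepi pmb; have := mulr_ge0 (ltW hk) D0 => D1 D2.
    move: Dpm; rewrite le_eqVlt => /predU1P[->//|lt].
    by rewrite ltW // ltr_cos // in_itv /= ?acos_ge0 //; apply/andP; split=> //; lra.
- exists id, 1; split => //.
    move=> x; apply: (@cvg_trans _ ((fun=> x) @ (0 : R)^'+)); last exact: cvg_cst.
    apply: near_eq_cvg; near=> e; rewrite mulrAC mulfV ?mul1r //.
  move=> p q r m a t b c D _ _ _ _ a0 t0 b0 c0 D0 _; rewrite k0 /model_dist ltxx !mul1r.
  have dE u v x : Num.sqrt ((u 0 1 - v 0 1) ^+ 2 + (u 0 2 - v 0 2) ^+ 2) = x ->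
      (u 0 1 - v 0 1) ^+ 2 + (u 0 2 - v 0 2) ^+ 2 = x ^+ 2.
    by move=> <-; rewrite sqr_sqrtr // addr_ge0 ?sqr_ge0.
  move=> /dE pq /dE qr /dE rp /dE qm /dE mr Dpm.
  have {Dpm} pm : D ^+ 2 <= (p 0 1 - m 0 1) ^+ 2 + (p 0 2 - m 0 2) ^+ 2.
    by rewrite -[leRHS]sqr_sqrtr ?addr_ge0 ?sqr_ge0 // ler_sqr ?nnegrE ?sqrtr_ge0.
  rewrite /small_stewart /=.
  (* The distances from [m] to the ends add up to the side, which makes [m] the corresponding
     weighted mean of [q] and [r]. *)
  have ww : ((a + t) * m 0 1 - a * q 0 1 - t * r 0 1) ^+ 2 +
            ((a + t) * m 0 2 - a * q 0 2 - t * r 0 2) ^+ 2 = 0.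
    transitivity ((a + t) * a * ((q 0 1 - m 0 1) ^+ 2 + (q 0 2 - m 0 2) ^+ 2) +
      (a + t) * t * ((m 0 1 - r 0 1) ^+ 2 + (m 0 2 - r 0 2) ^+ 2) -
      t * a * ((q 0 1 - r 0 1) ^+ 2 + (q 0 2 - r 0 2) ^+ 2)); first by ring.
    by rewrite qm mr qr; ring.
  have [at0|at0] := eqVneq (a + t) 0.
    have [-> ->] : a = 0 /\ t = 0 by split; lra.
    by rewrite /=; lra.
  have at1 : 0 < a + t by rewrite lt_neqAle eq_sym at0 addr_ge0.
  have sq0 x y : x ^+ 2 + y ^+ 2 = 0 -> x = 0 /\ y = 0.
    move=> xy; have := sqr_ge0 x; have := sqr_ge0 y => y2 x2.
    by split; apply/eqP; rewrite -sqrf_eq0; apply/eqP; lra.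
  have [w1 w2] := sq0 _ _ ww.
  suff : (a + t) * ((a + t) * D ^+ 2) <=
     (a + t) * (a * c ^+ 2 + t * b ^+ 2 - a * t * (a + t)).
    rewrite ler_pM2l //; set X := D ^+ 2; set Y := c ^+ 2; set Z := b ^+ 2.
    have -> : (D / 2) ^+ 2 = X / 4 by rewrite /X; field.
    have -> : (c / 2) ^+ 2 = Y / 4 by rewrite /Y; field.
    have -> : (b / 2) ^+ 2 = Z / 4 by rewrite /Z; field.
    lra.
  rewrite mulrA -expr2.
  apply: (@le_trans _ _ ((a + t) ^+ 2 * ((p 0 1 - m 0 1) ^+ 2 + (p 0 2 - m 0 2) ^+ 2))).
    by rewrite ler_wpM2l ?sqr_ge0.
  have mE1 : (a + t) * m 0 1 = a * q 0 1 + t * r 0 1 by lra.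
  have mE2 : (a + t) * m 0 2 = a * q 0 2 + t * r 0 2 by lra.
  have -> : (a + t) ^+ 2 * ((p 0 1 - m 0 1) ^+ 2 + (p 0 2 - m 0 2) ^+ 2) =
     ((a + t) * p 0 1 - (a + t) * m 0 1) ^+ 2 + ((a + t) * p 0 2 - (a + t) * m 0 2) ^+ 2.
    by ring.
  rewrite mE1 mE2 -pq -rp.
  have -> : a * t * (a + t) = (a * t) * (a + t) ^+ 2 / (a + t) by field.
  rewrite -qr le_eqVlt; apply/orP; left; apply/eqP; field.
  by [].
Unshelve. all: end_near. Qed.

End Models.

(** * Curvature bounds and dilations *)

Section Metric.
Variables (R : realType) (M : Type) (dist : M -> M -> R).
Hypothesis dist_refl : forall p, dist p p = 0.
Hypothesis distC : forall p q, dist p q = dist q p.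
Hypothesis distD : forall q p r, dist p r <= dist p q + dist q r.
Implicit Types (p q r x y : M) (g a b c : R -> M).

Lemma dist_ge0 p q : 0 <= dist p q.
Proof. by have := distD q p p; rewrite dist_refl (distC q p); lra. Qed.

Lemma sub_dball x y (e e' : R) : dist x y + e' <= e -> dball dist y e' `<=` dball dist x e.
Proof. by move=> xy z; rewrite /dball /=; have := distD y x z; lra. Qed.

Lemma sub_geodesic (A B : set M) p q g : A `<=` B ->
  geodesic dist A p q g -> geodesic dist B p q g.
Proof. by move=> AB [g0 gL gA gI]; split=> // t tL; apply: AB; exact: gA. Qed.

Lemma geodesic_dist (A : set M) p q g t : geodesic dist A p q g ->
  0 <= t <= dist p q -> dist p (g t) = t /\ dist (g t) q = dist p q - t.
Proof.
move=> [g0 gL gA gI] /andP[t0 tL]; split.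
  rewrite -{1}g0 gI ?in_itv /= ?lexx ?dist_ge0 ?t0 // sub0r normrN ger0_norm //.
rewrite -{1}gL gI ?in_itv /= ?lexx ?dist_ge0 ?t0 // distrC ger0_norm //; lra.
Qed.

(** Euclidean comparison in the form of Stewart's theorem, multiplied by the side length to avoid
    division. *)
Definition stewart p q r a := forall t, 0 <= t <= dist q r ->
  dist q r * dist p (a t) ^+ 2 <=
  (dist q r - t) * dist p q ^+ 2 + t * dist p r ^+ 2 - t * (dist q r - t) * dist q r.

Definition plane_point (X Y : R) : 'rV[R]_3 := \row_j [:: 1; X; Y]`_j.

Lemma plane_pointE X Y :
  [/\ plane_point X Y 0 0 = 1, plane_point X Y 0 1 = X & plane_point X Y 0 2 = Y].
Proof. by rewrite !mxE. Qed.

Lemma plane_surface X Y : model_surface 0 (plane_point X Y).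
Proof.
have [h0 h1 h2] := plane_pointE X Y.
by split; rewrite /model_form ?h0 ?sgr0 ?mul0r ?addr0 ?mulr1.
Qed.

Lemma plane_dist X Y X' Y' : model_dist 0 (plane_point X Y) (plane_point X' Y') =
  Num.sqrt ((X - X') ^+ 2 + (Y - Y') ^+ 2).
Proof.
have [_ h1 h2] := plane_pointE X Y; have [_ h1' h2'] := plane_pointE X' Y'.
by rewrite /model_dist ltxx h1 h2 h1' h2'.
Qed.

(** The comparison triangle is placed with one side on an axis; in the plane Stewart's relation is
    an equality, so the assumed inequality is the comparison of distances. *)
Lemma CAT0_stewart (A : set M) :
  (forall p q, A p -> A q -> exists g, geodesic dist A p q g) ->
  (forall p q r a, A p -> A q -> A r -> geodesic dist A q r a -> stewart p q r a) ->
  CAT dist A 0.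
Proof.
move=> exg st; split=> [p q Ap Aq _|p q r a b c Ap Aq Ar ga gb gc _]; first exact: exg.
set L := dist q r; set C := dist p q; set B := dist r p.
have L0 : 0 <= L := dist_ge0 _ _; have C0 : 0 <= C := dist_ge0 _ _.
have B0 : 0 <= B := dist_ge0 _ _.
have sqrtE (u v : R) : 0 <= v -> u = v ^+ 2 -> Num.sqrt u = v.
  by move=> v0 ->; rewrite sqrtr_sqr ger0_norm.
have [L00|Ln] := eqVneq L 0.
  have BC : B = C.
    have := distD r p q; have := distD q p r.
    by rewrite (distC r q) -/L L00 (distC p r) -/B -/C; lra.
  exists (plane_point C 0), (plane_point 0 0), (plane_point 0 0); split.
    split; rewrite ?plane_dist; first by split; exact: plane_surface.
    - by apply: sqrtE => //; rewrite -/C; ring.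
    - by apply: sqrtE => //; rewrite -/L L00; ring.
    - by apply: sqrtE => //; rewrite -/B BC; ring.
  move=> t; rewrite in_itv /= => /andP[t0 tL].
  have {tL} -> : t = 0 by apply/eqP; rewrite eq_le t0 andbT -L00.
  exists (plane_point 0 0); split; rewrite ?plane_dist; first exact: plane_surface.
  - by apply: sqrtE => //; ring.
  - by apply: sqrtE; rewrite -/L L00 subrr //; ring.
  - have [-> _ _ _] := ga; rewrite (sqrtE _ C) //; ring.
have Lp : 0 < L by rewrite lt_neqAle eq_sym Ln.
(* Abscissa of the third vertex by the law of cosines; the triangle inequalities make the height [Y]
   real. *)
pose X := (C ^+ 2 + L ^+ 2 - B ^+ 2) / (2 * L).
have XE : 2 * L * X = C ^+ 2 + L ^+ 2 - B ^+ 2 by rewrite /X; field.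
have t1 := distD r q p; have t2 := distD p q r; have t3 := distD q p r.
rewrite (distC q p) -/L -/C -/B in t1 t2.
rewrite (distC p r) -/L -/C -/B in t3.
rewrite (distC p r) -/B in t2.
have X1 : (L - C) ^+ 2 <= B ^+ 2.
  by rewrite -(real_normK (num_real (L - C))) ler_sqr ?nnegrE // ler_norml; lra.
have X2 : B ^+ 2 <= (L + C) ^+ 2 by rewrite ler_sqr ?nnegrE ?addr_ge0 //; lra.
have XC : X ^+ 2 <= C ^+ 2.
  rewrite -(real_normK (num_real X)) ler_sqr ?nnegrE // ler_norml.
  have L2 : 0 < 2 * L by lra.
  rewrite -(ler_pM2l L2) -[X in _ && X](ler_pM2l L2) XE; apply/andP.
  by split; lra.
have Y2 : 0 <= C ^+ 2 - X ^+ 2 by lra.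
pose Y := Num.sqrt (C ^+ 2 - X ^+ 2).
have YE : Y ^+ 2 = C ^+ 2 - X ^+ 2 by rewrite sqr_sqrtr.
exists (plane_point X Y), (plane_point 0 0), (plane_point L 0); split.
  split; rewrite ?plane_dist; first by split; exact: plane_surface.
  - by apply: sqrtE => //; rewrite !subr0 YE -/C; ring.
  - by apply: sqrtE => //; rewrite -/L; ring.
  - by apply: sqrtE => //; rewrite sub0r sqrrN YE sqrrB -/B mulr2n; lra.
move=> t; rewrite in_itv /= => /andP[t0 tL].
exists (plane_point t 0); split; rewrite ?plane_dist; first exact: plane_surface.
- by apply: sqrtE => //; ring.
- by apply: sqrtE; rewrite -/L; [lra|ring].
- have := @st p q r a Ap Aq Ar ga t; rewrite t0 tL => /(_ isT).
  rewrite (distC p r) -/L -/C -/B => h.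
  rewrite -[leLHS]ger0_norm ?dist_ge0 // -sqrtr_sqr ler_wsqrtr //.
  rewrite -(ler_pM2l Lp) (le_trans h) // subr0 YE sqrrB mulr2n.
  have -> : L * (X ^+ 2 - (X * t + X * t) + t ^+ 2 + (C ^+ 2 - X ^+ 2)) =
     L * t ^+ 2 + L * C ^+ 2 - t * (2 * L * X) by ring.
  rewrite XE; lra.
Qed.

(** Every term is a product of three values of [sn]; dividing by [e^3] and letting [e] tend to [0]
    replaces each [sn (e * z)] by [z]. *)
Lemma stewart_limit (sn : R -> R) (A t B C D e0 : R) : 0 < e0 ->
  (forall z, sn (e * z) / e @[e --> (0 : R)^'+] --> z) ->
  (forall e, 0 < e -> e < e0 -> small_stewart sn (e * A) (e * t) (e * B) (e * C) (e * D)) ->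
  (A + t) * D ^+ 2 <= A * C ^+ 2 + t * B ^+ 2 - t * A * (A + t).
Proof.
move=> e00 sn1 small.
pose s z e := sn (e * z) / e.
suff : (A + t) * (D / 2) ^+ 2 + A * (t / 2) ^+ 2 + t * (A / 2) ^+ 2 <=
       A * (C / 2) ^+ 2 + t * (B / 2) ^+ 2 by rewrite !exprMn; lra.
have lim2 u v : s u e * (s v e) ^+ 2 @[e --> (0 : R)^'+] --> u * v ^+ 2.
  by rewrite expr2; under eq_fun do rewrite expr2;
    apply: cvgM; [exact: sn1|apply: cvgM; exact: sn1].
apply: (@ler_cvg_to R (at_right (0 : R)) _ R
  (fun e => s (A + t) e * s (D / 2) e ^+ 2 + s A e * s (t / 2) e ^+ 2 + s t e * s (A / 2) e ^+ 2)
  (fun e => s A e * s (C / 2) e ^+ 2 + s t e * s (B / 2) e ^+ 2)).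
- by apply: cvgD; [apply: cvgD|].
- exact: cvgD.
near=> e.
have ep : 0 < e by near: e; exact: nbhs_right_gt.
have ee0 : e < e0 by near: e; exact: nbhs_right_lt.
have := small e ep ee0; rewrite /small_stewart /s -mulrDr -!mulrA => h.
have e3 : 0 < (e ^+ 3)^-1 by rewrite invr_gt0 exprn_gt0.
rewrite -(ler_pM2r e3) in h.
have en : e != 0 by rewrite gt_eqF.
move: h; set w1 := sn _; set w2 := sn _; set w3 := sn _; set w4 := sn _.
set w5 := sn _; set w6 := sn _; set w7 := sn _; set w8 := sn _ => h.
by apply: le_trans (le_trans h _); rewrite le_eqVlt; apply/orP; left; apply/eqP; field.
Unshelve. all: end_near. Qed.

Definition dilatable x := exists (e : R) (D : R -> M -> M), 0 < e /\
  forall l, 0 < l -> l <= 1 -> D l x = x /\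
    forall p q, dist x p < e -> dist x q < e -> dist (D l p) (D l q) = l * dist p q.

Lemma dilate_geodesic x (e r l : R) (f : M -> M) p q g : 0 < l -> l * e <= r ->
  f x = x ->
  (forall p q, dist x p < e -> dist x q < e -> dist (f p) (f q) = l * dist p q) ->
  dist x p < e -> dist x q < e ->
  geodesic dist (dball dist x e) p q g ->
  geodesic dist (dball dist x r) (f p) (f q) (fun t => f (g (t / l))).
Proof.
move=> l0 ler fx fl xp xq [g0 gL gA gI].
have e0 : 0 < e by exact: le_lt_trans (dist_ge0 _ _) xp.
have itvE t : t \in `[0, dist (f p) (f q)] -> t / l \in `[0, dist p q].
  rewrite fl // !in_itv /= => /andP[t0 tl].
  by rewrite divr_ge0 ?(ltW l0) //= ler_pdivrMr // mulrC.
split.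
- by rewrite mul0r g0.
- by rewrite fl // mulrAC mulfV ?gt_eqF // mul1r gL.
- move=> t /itvE/gA xg; rewrite /dball /= -{1}fx fl // ?dist_refl //.
  by apply: lt_le_trans ler; rewrite ltr_pM2l.
- move=> s t sI tI; rewrite fl; [|exact: gA (itvE _ _)..].
  rewrite gI ?itvE // -mulrBl normrM (gtr0_norm (x := l^-1)) ?invr_gt0 //.
  by rewrite mulrC divfK ?gt_eqF.
Qed.

(** Copies of the triangle shrunk towards [x] all satisfy comparison with curvature [k], and their
    inequalities pass to the Euclidean one in the limit. *)
Lemma CAT_stewart x (r k e : R) (f : R -> M -> M) p q s a b c :
  CAT dist (dball dist x r) k -> 0 < e -> e <= r ->
  (forall l, 0 < l -> l <= 1 -> f l x = x /\
    forall p q, dist x p < e -> dist x q < e -> dist (f l p) (f l q) = l * dist p q) ->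
  dist x p < e -> dist x q < e -> dist x s < e ->
  geodesic dist (dball dist x e) q s a ->
  geodesic dist (dball dist x e) s p b ->
  geodesic dist (dball dist x e) p q c ->
  stewart p q s a.
Proof.
move=> [_ cat] e0 er fP xp xq xs ga gb gc t /andP[t0 tL].
have [sn [h [h0 sn1 sts]]] := model_stewart k.
have pi0 := trigo.pi_gt0 R.
set L := dist q s in tL *; have L0 : 0 <= L := dist_ge0 _ _.
pose per := dist p q + dist q s + dist s p.
have per0 : 0 <= per by rewrite !addr_ge0 ?dist_ge0.
pose K := if 0 < k then 2 * trigo.pi / Num.sqrt k else 1.
have K0 : 0 < K.
  by rewrite /K; case: ifP => // k0; rewrite divr_gt0 ?sqrtr_gt0 //; lra.
(* Ratios below [l0] are admissible for the dilation, keep the perimeter under its bound when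
   [k > 0], and keep the scaled side at most pi; the added [1] keeps denominators positive. *)
pose l0 := Num.min 1 (Num.min (K / (per + 1)) (trigo.pi / (h * L + 1))).
have hL0 : 0 <= h * L by rewrite mulr_ge0 // ltW.
have l00 : 0 < l0 by rewrite !lt_min ltr01 !divr_gt0 //; lra.
have -> : L = (L - t) + t by lra.
have -> : L - t + t - t = L - t by lra.
rewrite (distC p s); apply: (@stewart_limit sn _ _ _ _ _ (h * l0)) => //.
  by rewrite mulr_gt0.
move=> ee ee0 eel.
have [l lE lp] : exists2 l, ee = h * l & 0 < l.
  by exists (ee / h); rewrite ?divr_gt0 // mulrC divfK ?gt_eqF.
have : l < l0 by rewrite -(ltr_pM2l h0) -lE.
rewrite !lt_min => /and3P[l1 lK lpi].
have {lK} lK : l * per < K.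
  rewrite ltr_pdivlMr in lK; last by lra.
  by apply: le_lt_trans lK; rewrite ler_pM2l //; lra.
have {lpi} lpi : h * (l * L) <= trigo.pi.
  rewrite ltr_pdivlMr in lpi; last by lra.
  by rewrite mulrCA; lra.
have [fx fl] := fP l lp (ltW l1).
have ler : l * e <= r by apply: le_trans er; rewrite ler_piMl ?ltW.
have inb y : dist x y < e -> dball dist x r (f l y).
  move=> xy; rewrite /dball /= -{1}fx fl // ?dist_refl //.
  by apply: lt_le_trans ler; rewrite ltr_pM2l.
have [|p' [q' [s' [[[p'S q'S s'S] dpq dqs dsp] mm]]]] := cat _ _ _ _ _ _ (inb _ xp) (inb _ xq) (inb _ xs)
  (dilate_geodesic lp ler fx fl xq xs ga) (dilate_geodesic lp ler fx fl xs xp gb)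
  (dilate_geodesic lp ler fx fl xp xq gc).
  by move=> k0; rewrite !fl // -!mulrDr; move: lK; rewrite /K k0.
rewrite !fl // in dpq dqs dsp.
have [|m' [m'S dqm dms dpm]] := mm (l * t).
  by rewrite fl // in_itv /= mulr_ge0 ?(ltW lp) //= ler_pM2l.
have [_ _ gaA _] := ga.
have xat : dist x (a t) < e by apply: gaA; rewrite in_itv /= t0.
rewrite mulrAC mulfV ?gt_eqF // mul1r fl // in dpm.
rewrite fl // in dms.
rewrite lE -!mulrA; apply: (sts p' q' s' m' _ _ _ _ _ p'S q'S s'S m'S) => //;
  rewrite ?mulr_ge0 ?dist_ge0 ?(ltW lp) //.
- by rewrite subr_ge0.
- by rewrite -mulrDr subrK.
- by rewrite -mulrDr subrK.
- by rewrite dms -/L; ring.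
Qed.

(** A dilation makes the sides of a triangle arbitrarily small, and at small
    scale the comparison triangles of any curvature become Euclidean. *)
Lemma CAT_dilatable x (r k : R) : dilatable x -> 0 < r ->
  CAT dist (dball dist x r) k ->
  exists2 e, 0 < e & forall y, dist x y < e ->
    exists2 r', 0 < r' & CAT dist (dball dist y r') 0.
Proof.
move=> [e0 [f [e00 fP]]] r0 cat.
pose e := Num.min e0 r.
have ep : 0 < e by rewrite lt_min e00.
have ee0 : e <= e0 by rewrite ge_min lexx.
have er : e <= r by rewrite ge_min lexx orbT.
pose K := if 0 < k then trigo.pi / Num.sqrt k else 1.
have K0 : 0 < K.
  by rewrite /K; case: ifP => // k0; rewrite divr_gt0 ?sqrtr_gt0 ?trigo.pi_gt0.
(* Points within [d] of [x] are less than [2 * d] apart, so geodesics between them exist, and these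
   stay within [2 * d] of [x]. *)
pose d := Num.min (e / 3) (K / 2).
have dp : 0 < d by rewrite lt_min; apply/andP; split; lra.
have de3 : d <= e / 3 by rewrite ge_min lexx.
have dK2 : d <= K / 2 by rewrite ge_min lexx orbT.
have de : 3 * d <= e by lra.
have dK : 2 * d <= K by lra.
have exg p q : dist x p < d -> dist x q < d ->
    exists g, geodesic dist (dball dist x e) p q g.
  move=> xp xq; have pq : dist p q < 2 * d.
    by have := distD x p q; rewrite (distC p x); lra.
  have [||k0|g gg] := cat.1 p q; rewrite /dball /=; try lra.
    by move: dK; rewrite /K k0; lra.
  exists g; have [g0 gL gA gI] := gg; split=> // t tL.
  have := tL; rewrite in_itv /= => tI.
  have [h1 h2] := geodesic_dist gg tI.
  have := distD p x (g t); have := distD q x (g t).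
  rewrite (distC q) h1 h2 /dball /=; lra.
have st p q s a : dist x p < d -> dist x q < d -> dist x s < d ->
    geodesic dist (dball dist x e) q s a -> stewart p q s a.
  move=> xp xq xs ga; have [b gb] := exg s p xs xp; have [c gc] := exg p q xp xq.
  apply: (CAT_stewart (f := f) cat ep er _ _ _ _ ga gb gc); try lra.
  move=> l l0 l1; have [fx fl] := fP l l0 l1; split=> // u v xu xv; apply: fl; lra.
exists (d / 2); first by lra.
move=> y xy; exists (d / 2); first by lra.
have yd z : dball dist y (d / 2) z -> dist x z < d.
  by rewrite /dball /=; have := distD y x z; lra.
apply: CAT0_stewart.
  move=> p q yp yq; have [g gg] := exg p q (yd _ yp) (yd _ yq).
  exists g; have [g0 gL gA gI] := gg; split=> // t.
  rewrite in_itv /= => /andP[t0 tL].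
  have [L00|Ln] := eqVneq (dist p q) 0.
    have -> : t = 0 by apply/eqP; rewrite eq_le t0 andbT -L00.
    by rewrite g0.
  have Lp : 0 < dist p q by rewrite lt_neqAle eq_sym Ln dist_ge0.
  have xy' : dist x y < d by lra.
  (* Stewart's inequality with the centre [y] as vertex keeps geodesics between points of its ball
     of radius [d / 2] inside that ball. *)
  have := st y p q g xy' (yd _ yp) (yd _ yq) gg t; rewrite t0 tL => /(_ isT) h.
  rewrite /dball /= -ltr_sqr ?nnegrE ?dist_ge0 //; last by lra.
  rewrite -(ltr_pM2l Lp); apply: le_lt_trans h _.
  have sq z : dist y z < d / 2 -> dist y z ^+ 2 < (d / 2) ^+ 2.
    by move=> yz; rewrite ltr_sqr ?nnegrE ?dist_ge0 //; lra.
  have sp := sq p yp; have sq' := sq q yq.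
  have n1 : 0 <= t * (dist p q - t) * dist p q by rewrite !mulr_ge0 ?subr_ge0 ?dist_ge0.
  have n2 : (dist p q - t) * dist y p ^+ 2 <= (dist p q - t) * (d / 2) ^+ 2.
    by rewrite ler_wpM2l ?subr_ge0 // ltW.
  have n3 : t * dist y q ^+ 2 <= t * (d / 2) ^+ 2 by rewrite ler_wpM2l // ltW.
  have [t00|tn] := eqVneq t 0.
    rewrite t00 subr0 !mul0r addr0 subr0 ltr_pM2l //.
  have tp : 0 < t by rewrite lt_neqAle eq_sym tn.
  have n4 : t * dist y q ^+ 2 < t * (d / 2) ^+ 2 by rewrite ltr_pM2l.
  have -> : dist p q * (d / 2) ^+ 2 = (dist p q - t) * (d / 2) ^+ 2 + t * (d / 2) ^+ 2 by ring.
  lra.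
move=> p q s a yp yq ys ga; apply: st; [exact: yd..|].
apply: sub_geodesic ga; apply: sub_dball; lra.
Qed.

Lemma generically_nonpositively_curved_dilatable :
  (forall x, dilatable x) ->
  (forall x (e : R), 0 < e -> exists2 y, dist x y < e &
     exists r' k : R, 0 < r' /\ CAT dist (dball dist y r') k) ->
  generically_nonpositively_curved dist.
Proof.
move=> dil dense.
pose G : set M := [set x | exists r k : R, 0 < r /\ CAT dist (dball dist x r) k].
have Gball x : G x -> exists2 e, 0 < e & forall y, dist x y < e ->
    exists2 r', 0 < r' & CAT dist (dball dist y r') 0.
  by move=> [r [k [r0 cat]]]; exact: CAT_dilatable (dil x) r0 cat.
exists G; split.
- move=> x /Gball[e e0 eP]; exists e => // y /eP[r' r'0 cat].
  by exists r', 0.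
- by move=> x r r0; have [y xy yG] := dense x r r0; exists y.
- move=> x /Gball[e e0 eP]; exists (dball dist x e); split.
  + move=> y xy; exists (e - dist x y); first by move: xy; rewrite /dball /=; lra.
    by apply: sub_dball; lra.
  + by rewrite /dball /= dist_refl.
  + by move=> y /eP.
- by move=> x nG r k r0 cat; apply: nG; exists r, k.
Qed.

(** * Taxicab squares *)

Definition has_taxicab_square (A : set M) := exists (e : R) (f : R -> R -> M),
  0 < e /\ forall s t, 0 <= s <= e -> 0 <= t <= e -> A (f s t) /\
    forall s' t', 0 <= s' <= e -> 0 <= t' <= e ->
      dist (f s t) (f s' t') = `|s - s'| + `|t - t'|.

(** The two geodesics follow opposite halves of the boundary between two opposite corners; at time
    [e] they are at the other two corners. *)
Lemma taxicab_geodesics (A : set M) : has_taxicab_square A -> exists p q m (e : R) g g',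
  [/\ geodesic dist A p q g, geodesic dist A p q g',
      [/\ 0 < e, dist p q = 2 * e & dist (g e) m = 2 * e],
      dist m p = e & g' e = m /\ dist m q = e].
Proof.
move=> [e [f [e0 fP]]].
have I0 : 0 <= (0 : R) <= e by rewrite lexx ltW.
have Ie : 0 <= e <= e by rewrite lexx ltW.
have dE s t s' t' : 0 <= s <= e -> 0 <= t <= e -> 0 <= s' <= e -> 0 <= t' <= e ->
    dist (f s t) (f s' t') = `|s - s'| + `|t - t'|.
  by move=> hs ht; exact: (fP s t hs ht).2.
have clamp1 t : 0 <= t <= 2 * e -> 0 <= Num.min t e <= e.
  by move=> h; rewrite le_min ge_min lexx orbT andbT; lra.
have clamp2 t : 0 <= t <= 2 * e -> 0 <= Num.max (t - e) 0 <= e.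
  by move=> h; rewrite ge_max le_max lexx orbT /=; lra.
have clampD s t : `|Num.min s e - Num.min t e| + `|Num.max (s - e) 0 - Num.max (t - e) 0| = `|s - t|.
  have [hs|hs] := ltP s e; have [ht|ht] := ltP t e.
  - by rewrite !max_r ?subrr ?normr0 ?addr0 //; lra.
  - rewrite max_r ?max_l; [|lra..].
    by rewrite !ler0_norm; lra.
  - rewrite max_l ?max_r; [|lra..].
    by rewrite !ger0_norm; lra.
  - rewrite !max_l; [|lra..].
    by rewrite subrr normr0 add0r; congr `|_|; ring.
have L : dist (f 0 0) (f e e) = 2 * e.
  by rewrite dE // sub0r normrN gtr0_norm //; ring.
exists (f 0 0), (f e e), (f 0 e), e.
exists (fun t => f (Num.min t e) (Num.max (t - e) 0)), (fun t => f (Num.max (t - e) 0) (Num.min t e)).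
have m0 : Num.min 0 e = 0 by rewrite min_l // ltW.
have M0 : Num.max (0 - e) 0 = 0 by rewrite max_r //; lra.
have m2 : Num.min (2 * e) e = e by rewrite min_r //; lra.
have M2 : Num.max (2 * e - e) 0 = e by rewrite max_l; lra.
have me : Num.min e e = e by rewrite minxx.
have Me : Num.max (e - e) 0 = 0 by rewrite subrr maxxx.
split.
- split; rewrite ?L ?m0 ?M0 ?m2 ?M2 //.
    by move=> t; rewrite in_itv /= => tI; exact: (fP _ _ (clamp1 _ tI) (clamp2 _ tI)).1.
  by move=> s t; rewrite !in_itv /= => sI tI; rewrite dE ?clamp1 ?clamp2 // clampD.
- split; rewrite ?L ?m0 ?M0 ?m2 ?M2 //.
    by move=> t; rewrite in_itv /= => tI; exact: (fP _ _ (clamp2 _ tI) (clamp1 _ tI)).1.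
  by move=> s t; rewrite !in_itv /= => sI tI; rewrite dE ?clamp1 ?clamp2 // addrC clampD.
- split=> //; rewrite me Me dE // subr0 sub0r normrN gtr0_norm //; ring.
- by rewrite dE // subrr normr0 add0r subr0 gtr0_norm.
- by rewrite me Me; split=> //; rewrite dE // sub0r normrN subrr normr0 addr0 gtr0_norm.
Qed.

(** Two geodesics with common ends refute uniqueness directly; by [CAT_dilatable] any curvature
    bound would yield a [CAT] ball of bound [0] that contains a square. *)
Lemma nowhere_unique_infinitely_curved_dilatable :
  (forall x, dilatable x) ->
  (forall x (e : R), 0 < e -> exists2 y, dist x y < e &
     forall r' : R, 0 < r' -> has_taxicab_square (dball dist y r')) ->
  nowhere_unique_infinitely_curved dist.
Proof.
move=> dil dense; split=> x.
  move=> [U [oU Ux uU]]; have [r r0 rU] := oU x Ux.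
  have [y xy sq] := dense x r r0.
  have [|p [q [m [e [g [g' [gg gg' [e0 L gm] mp [g'e mq]]]]]]]] :=
    taxicab_geodesics (sq (r - dist x y) _); first by lra.
  have inU z : dball dist y (r - dist x y) z -> U z.
    by move=> yz; apply: rU; apply: sub_dball yz; lra.
  have [gp gq gA _] := gg.
  have Up : U p by apply: inU; rewrite -gp; apply: gA; rewrite in_itv /= L; lra.
  have Uq : U q by apply: inU; rewrite -gq; apply: gA; rewrite in_itv /= L; lra.
  have [h _ hu] := uU p q Up Uq.
  have eI : e \in `[0, dist p q] by rewrite in_itv /= L; lra.
  have := hu g (sub_geodesic (subsetT _) gg) e eI.
  have := hu g' (sub_geodesic (subsetT _) gg') e eI.
  move=> <- ge; move: gm; rewrite ge g'e dist_refl; lra.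
move=> r k r0 cat; have [e e0 eP] := CAT_dilatable (dil x) r0 cat.
have [y xy sq] := dense x e e0.
have [r' r'0 [_ cat0]] := eP y xy.
have [p [q [m [l [g [g' [gg gg' [l0 L gm] mp [g'l mq]]]]]]]] := taxicab_geodesics (sq r' r'0).
have [gp gq gA gI] := gg'.
have lI t : 0 <= t <= 2 * l -> dball dist y r' (g' t).
  by move=> tI; apply: gA; rewrite in_itv /= L.
have Ap : dball dist y r' p by rewrite -gp; apply: lI; lra.
have Aq : dball dist y r' q by rewrite -gq L; apply: lI; lra.
have Am : dball dist y r' m by rewrite -g'l; apply: lI; lra.
(* Reversing [g'] splits it at [m] into the sides from [q] to [m] and from [m] to [p]; [g] is the
   side opposite [m]. *)
have gb : geodesic dist (dball dist y r') q m (fun t => g' (2 * l - t)).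
  have qm : dist q m = l by rewrite distC.
  split; rewrite ?qm ?subr0 -?L //.
  - by rewrite L -g'l; congr g'; ring.
  - by move=> t; rewrite in_itv /= => tI; rewrite L; apply: lI; lra.
  - move=> s t; rewrite !in_itv /= L => sI tI; rewrite gI ?in_itv /= ?L; try lra.
    by rewrite distrC; congr `|_|; ring.
have gc : geodesic dist (dball dist y r') m p (fun t => g' (l - t)).
  split; rewrite ?mp ?subr0 ?subrr //.
  - by move=> t; rewrite in_itv /= => tI; apply: lI; lra.
  - move=> s t; rewrite !in_itv /= => sI tI; rewrite gI ?in_itv /= ?L; try lra.
    by rewrite distrC; congr `|_|; ring.
have [|p' [q' [s' [[_ dpq dqs dsp] mm]]]] := cat0 m p q g _ _ Am Ap Aq gg gb gc.
  by rewrite ltxx.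
have [|m' [_ dqm dms dpm]] := mm l; first by rewrite in_itv /= L; lra.
move: dpq dqs dsp dqm dms dpm; rewrite /model_dist ltxx mp L (distC q m) mq (distC m) gm.
have dE (u v : 'rV[R]_3) z : Num.sqrt ((u 0 1 - v 0 1) ^+ 2 + (u 0 2 - v 0 2) ^+ 2) = z ->
    (u 0 1 - v 0 1) ^+ 2 + (u 0 2 - v 0 2) ^+ 2 = z ^+ 2.
  by move=> <-; rewrite sqr_sqrtr // addr_ge0 ?sqr_ge0.
move=> /dE H1 /dE H2 /dE H3 /dE H4 /dE H5.
(* [p'] and [m'] are both the midpoint of the planar segment [q' s'] *)
have -> : (p' 0 1 - m' 0 1) ^+ 2 + (p' 0 2 - m' 0 2) ^+ 2 = 0.
  have S1 := sqr_ge0 (2 * p' 0 1 - q' 0 1 - s' 0 1).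
  have S2 := sqr_ge0 (2 * p' 0 2 - q' 0 2 - s' 0 2).
  have S3 := sqr_ge0 (2 * m' 0 1 - q' 0 1 - s' 0 1).
  have S4 := sqr_ge0 (2 * m' 0 2 - q' 0 2 - s' 0 2).
  have sq0 (z : R) : z ^+ 2 <= 0 -> z = 0.
    by move=> z2; apply/eqP; rewrite -sqrf_eq0 eq_le z2 sqr_ge0.
  have Z1 : 2 * p' 0 1 - q' 0 1 - s' 0 1 = 0 by apply: sq0; lra.
  have Z2 : 2 * p' 0 2 - q' 0 2 - s' 0 2 = 0 by apply: sq0; lra.
  have Z3 : 2 * m' 0 1 - q' 0 1 - s' 0 1 = 0 by apply: sq0; lra.
  have Z4 : 2 * m' 0 2 - q' 0 2 - s' 0 2 = 0 by apply: sq0; lra.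
  have -> : p' 0 1 = m' 0 1 by lra.
  have -> : p' 0 2 = m' 0 2 by lra.
  by rewrite !subrr expr0n addr0.
rewrite sqrtr0; lra.
Qed.

End Metric.

(** * Generic shapes *)

Section Generic.
Variables (R : realType) (d n : nat) (T : btree).
Local Notation X := (preshape R d n T).
Variables (N : X -> R) (hN : shape_norm N).
Variable F : {set {set edge T}}.
Local Notation inZ := (restricted_preshape R d n F).
Local Notation cdist := (chain_dist N F).
Implicit Types x y z u v w : X.

Lemma card_supp x y : collapse x = collapse y -> #|supp x| = #|supp y|.
Proof. by move=> /collapse_transportP[s [sI <- _ _]]; rewrite card_in_imset. Qed.

Lemma norm_eq0 x : N x = 0 -> x = 0.
Proof.
move=> x0; apply/ffunP => e; rewrite ffunE; apply/eqP; rewrite -enorm_eq0.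
by rewrite eq_le enorm_ge0 andbT -x0 norm_coord.
Qed.

(** If a representative can still gain edges of an allowed [E], a small perturbation makes all of
    [E] nonzero and enlarges the support, which can happen only finitely often. *)
Lemma generic_dense z (e : R) : (0 < d)%N -> (0 < n)%N -> inZ z -> 0 < e ->
  exists x, [/\ inZ x, generic F x & cdist z x < e].
Proof.
move=> d0 n0; have [m] := ubnP (#|edge T| - #|supp z|).
elim: m z e => // m IH z e lem zZ e0.
have [[y [E [yZ yz EF yE Ey]]]|ng] := pselect (exists y E,
    [/\ inZ y, collapse y = collapse z, E \in F, supp y \subset E & ~~ (E \subset supp y)]);
  last first.
  exists z; split=> //; last by rewrite chain_dist_eqv.
  move=> y E yZ yz EF yE; have [//|Ey] := boolP (E \subset supp y).
  by exfalso; apply: ng; exists y, E.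
pose b : X := [ffun f => if f \in E :\: supp y then const_mx 1 else 0].
have one0 : const_mx 1 != 0 :> 'M[R]_(n, d).
  apply/eqP => /matrixP/(_ (Ordinal n0) (Ordinal d0)); rewrite !mxE => /eqP.
  by rewrite oner_eq0.
have Nb := norm_ge0 hN b.
pose a := e / (2 * (N b + 1)).
have a0 : 0 < a by rewrite divr_gt0 // mulr_gt0 //; lra.
pose y' := y + a *: b.
have sy' : supp y' = E.
  apply/setP => f; rewrite !finset.inE !ffunE !finset.inE.
  have [yf|yf] := eqVneq (y f) 0; rewrite /=.
    rewrite yf add0r; case: ifP => fE; rewrite ?scaler0 ?eqxx //.
    by rewrite scaler_eq0 negb_or (gt_eqF a0).
  by rewrite scaler0 addr0 yf; apply/esym/(fintype.subsetP yE); rewrite finset.inE.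
have y'Z : inZ y' by apply/inZP; exists E; rewrite ?sy'.
have card : (#|supp z| < #|supp y'|)%N.
  by rewrite -(card_supp yz) sy'; apply/proper_card/andP.
have e2 : 0 < e / 2 by lra.
have [|x [xZ gx y'x]] := IH y' (e / 2) _ y'Z e2.
  have := max_card (mem (supp y')); move: lem; set q := #|edge T| => lem le.
  rewrite -ltnS; apply: leq_trans lem; rewrite ltnS ltn_sub2l //.
  exact: leq_trans card le.
exists x; split=> //; apply: le_lt_trans (chain_distD hN zZ y'Z xZ) _.
suff : cdist z y' < e / 2 by lra.
rewrite (chain_dist_eqv2 hN zZ yZ y'Z y'Z (esym yz) erefl).
apply: le_lt_trans (chain_dist_joinable hN _) _; first by exists E; rewrite ?sy'.
rewrite /y' opprD addrA subrr add0r normN // (normZ hN) gtr0_norm // /a.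
have : 0 < N b + 1 by lra.
move=> Nb1; rewrite mulrAC ltr_pdivrMr ?mulr_gt0 //; lra.
Qed.

(** A shape with at most one nonzero edge has a representative supported inside [E]; as [E] has two
    edges, that representative could gain one. *)
Lemma generic_two_edges x : (exists2 E, E \in F & (1 < #|E|)%N) ->
  inZ x -> generic F x -> exists e1 e2, [/\ e1 != e2, e1 \in supp x & e2 \in supp x].
Proof.
move=> [E EF E1] xZ gx.
suff /card_gt1P[e1 [e2 [h1 h2 h]]] : (1 < #|supp x|)%N by exists e1, e2.
rewrite ltnNge; apply/negP => le1.
have xE_contra (y : X) : collapse y = collapse x -> supp y \subset E -> False.
  move=> yx yE; have yZ : inZ y by apply/inZP; exists E.
  have := subset_leq_card (gx y E yZ yx EF yE); rewrite (card_supp yx).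
  by rewrite leqNgt (leq_ltn_trans le1).
have [s0|[e ex]] := set_0Vmem (supp x).
  by apply: (xE_contra x) => //; rewrite s0 finset.sub0set.
have [f fE] : exists f, f \in E by apply/card_gt0P; apply: ltn_trans E1.
have xb : x = single_edge e (x e).
  apply/ffunP => g; rewrite ffunE; case: eqP => [->//|/eqP ge].
  apply: suppPn; apply: contraTN le1 => gx'; rewrite -ltnNge.
  by apply/card_gt1P; exists g, e.
apply: (xE_contra (single_edge f (x e))); first by rewrite [in RHS]xb; exact: collapse_single_edge.
by apply: fintype.subset_trans (supp_single_edge _ _) _; rewrite finset.sub1set.
Qed.

End Generic.

(** * Identities for the two norms *)

Section Norm12.
Variables (R : realType) (d n : nat) (T : btree).
Local Notation X := (preshape R d n T).
Implicit Types x y u v w m : X.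

Lemma norm2_sqr x : norm2 x ^+ 2 =
  \sum_(k : edge T * ('I_n * 'I_d)) x k.1 k.2.1 k.2.2 ^+ 2.
Proof.
rewrite /norm2 sqr_sqrtr; last by apply: sumr_ge0 => e _; exact: sqr_ge0.
rewrite -(pair_big xpredT xpredT (fun e p => x e p.1 p.2 ^+ 2)) /=.
apply: eq_bigr => e _; rewrite enormE sqr_sqrtr //.
by apply: sumr_ge0 => p _; exact: sqr_ge0.
Qed.

(** The distances force [L m = (L - t) v + t w] in every coordinate, because the sum of the squared
    defects vanishes; the rest is algebra in the coordinates. *)
Lemma norm2_stewart u v w m (L t : R) : 0 < L ->
  norm2 (v - w) = L -> norm2 (v - m) = t -> norm2 (m - w) = L - t ->
  L * norm2 (u - m) ^+ 2 =
  (L - t) * norm2 (u - v) ^+ 2 + t * norm2 (u - w) ^+ 2 - t * (L - t) * L.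
Proof.
move=> L0 /(congr1 (fun z => z ^+ 2)) vw /(congr1 (fun z => z ^+ 2)) vm.
move=> /(congr1 (fun z => z ^+ 2)) mw.
rewrite !norm2_sqr in vw vm mw *.
pose c (x : X) (k : edge T * ('I_n * 'I_d)) := x k.1 k.2.1 k.2.2.
have dE x y : \sum_k (c (x - y) k) ^+ 2 = \sum_k (c x k - c y k) ^+ 2.
  by apply: eq_bigr => k _; rewrite /c !ffunE !mxE.
rewrite -/(c _ _) in vw vm mw *.
have {}vw : \sum_k (c v k - c w k) ^+ 2 = L ^+ 2 by rewrite -dE.
have {}vm : \sum_k (c v k - c m k) ^+ 2 = t ^+ 2 by rewrite -dE.
have {}mw : \sum_k (c m k - c w k) ^+ 2 = (L - t) ^+ 2 by rewrite -dE.
have z : \sum_k (L * c m k - (L - t) * c v k - t * c w k) ^+ 2 = 0.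
  transitivity (L * (L - t) * \sum_k (c v k - c m k) ^+ 2 +
     L * t * \sum_k (c m k - c w k) ^+ 2 - t * (L - t) * \sum_k (c v k - c w k) ^+ 2).
    rewrite !mulr_sumr -big_split -sumrB /=; apply: eq_bigr => k _; ring.
  rewrite vw vm mw; ring.
have mE k : L * c m k = (L - t) * c v k + t * c w k.
  move/eqP: z; rewrite psumr_eq0 => [/allP/(_ k)|i _]; last exact: sqr_ge0.
  rewrite mem_index_enum /= sqrf_eq0 => /(_ isT)/eqP; lra.
apply: (@mulfI _ L); first by rewrite gt_eqF.
rewrite mulrA -expr2.
transitivity (\sum_k (L * c u k - L * c m k) ^+ 2).
  rewrite -[in LHS]/(\sum_k (c (u - m) k) ^+ 2) dE mulr_sumr; apply: eq_bigr => k _; ring.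
transitivity (L * (L - t) * \sum_k (c u k - c v k) ^+ 2 + L * t * \sum_k (c u k - c w k) ^+ 2
   - t * (L - t) * \sum_k (c v k - c w k) ^+ 2).
  rewrite !mulr_sumr -big_split -sumrB /=; apply: eq_bigr => k _; rewrite mE; ring.
rewrite vw -!dE /c; ring.
Qed.

Lemma norm1_two_edges (e1 e2 : edge T) (A B : 'M[R]_(n, d)) : e1 != e2 ->
  norm1 (single_edge e1 A + single_edge e2 B) = enorm A + enorm B.
Proof.
move=> e12; rewrite /norm1 (bigD1 e1) //= (bigD1 e2) 1?eq_sym //= big1 => [|e].
  by rewrite !ffunE !eqxx (negPf e12) eq_sym (negPf e12) addr0 add0r addr0.
by move=> /andP[/negPf h1 /negPf h2]; rewrite !ffunE h1 h2 addr0 enorm0.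
Qed.

End Norm12.

(** * Shape spaces as quotients of the chain metric *)

Section Shapes.
Variables (R : realType) (d n : nat) (T : btree).
Local Notation X := (preshape R d n T).
Variables (N : X -> R) (hN : shape_norm N).
Variable F : {set {set edge T}}.
Local Notation inZ := (restricted_preshape R d n F).
Local Notation cdist := (chain_dist N F).
(** An abstract shape space: [rep] picks a representative and [mk] takes the class. The full and the
    restricted spaces are both instances. *)
Variables (M : Type) (dist : M -> M -> R) (rep : M -> X) (mk : X -> M).
Hypothesis repZ : forall p, inZ (rep p).
Hypothesis distE : forall p q, dist p q = cdist (rep p) (rep q).
Hypothesis mkP : forall x, inZ x -> collapse (rep (mk x)) = collapse x.
Hypothesis mk_rep : forall x p, inZ x -> collapse x = collapse (rep p) -> mk x = p.
Hypotheses (d0 : (0 < d)%N) (n0 : (0 < n)%N).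
Implicit Types (x y u v w : X) (p q r : M).

Lemma shape_refl p : dist p p = 0.
Proof. by rewrite distE chain_dist_eqv. Qed.

Lemma shape_distC p q : dist p q = dist q p.
Proof. by rewrite !distE (chain_distC hN). Qed.

Lemma shape_distD q p r : dist p r <= dist p q + dist q r.
Proof. by rewrite !distE (chain_distD hN). Qed.

Lemma dist_mk x y : inZ x -> inZ y -> dist (mk x) (mk y) = cdist x y.
Proof. by move=> xZ yZ; rewrite distE; apply: chain_dist_eqv2 => //; exact: mkP. Qed.

Lemma dist_mkl x p : inZ x -> dist (mk x) p = cdist x (rep p).
Proof. by move=> xZ; rewrite distE; apply: chain_dist_eqv2 => //; exact: mkP. Qed.

Lemma shape_dilatable p : dilatable dist p.
Proof.
have [r [D [r0 DP]]] := chain_dilation hN (repZ p).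
exists r, (fun l q => mk (D l (rep q))); split=> // l l0 l1.
have [Dx [DZ Dd]] := DP l l0 l1; split; first by rewrite Dx; exact: mk_rep.
move=> q s; rewrite !distE => pq ps.
by rewrite -!distE dist_mk ?distE ?Dd //; apply: DZ.
Qed.

Lemma mk_dense p (e : R) : 0 < e ->
  exists x, [/\ inZ x, generic F x & dist p (mk x) < e].
Proof.
move=> e0; have [x [xZ gx px]] := generic_dense hN d0 n0 (repZ p) e0.
by exists x; split=> //; rewrite shape_distC dist_mkl // (chain_distC hN).
Qed.

Lemma shape_chart x : inZ x -> generic F x -> exists2 e, 0 < e &
  (forall u v, supp u \subset supp x -> supp v \subset supp x ->
     N (u - x) < e -> N (v - x) < e -> dist (mk u) (mk v) = N (u - v)) /\
  (forall p, dist (mk x) p < e ->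
     exists u, [/\ supp u \subset supp x, mk u = p & N (u - x) < e]).
Proof.
move=> xZ gx; have [e e0 [c1 c2]] := generic_chart hN xZ gx.
exists e => //; split=> [u v us vs ux vx|p].
  by rewrite dist_mk ?c1 //; [apply: inZ_supp us xZ|apply: inZ_supp vs xZ].
rewrite dist_mkl // => xp; have [u [us up ux]] := c2 (rep p) (repZ p) xp.
by exists u; split=> //; apply: mk_rep up; apply: inZ_supp us xZ.
Qed.

(** Two nonzero edges are varied independently along one unit direction; in the chart these shapes
    have taxicab distances. *)
Lemma generic_taxicab x e1 e2 : N =1 @norm1 R d n T -> inZ x -> generic F x ->
  e1 != e2 -> e1 \in supp x -> e2 \in supp x ->
  forall r : R, 0 < r -> has_taxicab_square dist (dball dist (mk x) r).
Proof.
move=> N1 xZ gx e12 e1x e2x r r0.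
have [e e0 [c1 _]] := shape_chart xZ gx.
pose U : 'M[R]_(n, d) := delta_mx (Ordinal n0) (Ordinal d0).
pose P (s t : R) : X := x + (single_edge e1 (s *: U) + single_edge e2 (t *: U)).
pose a := Num.min e r / 3.
have m0 : 0 < Num.min e r by rewrite lt_min e0.
have me : Num.min e r <= e by rewrite ge_min lexx.
have mr : Num.min e r <= r by rewrite ge_min lexx orbT.
have a0 : 0 < a by rewrite /a; lra.
have aE : 3 * a = Num.min e r by rewrite /a; field.
have Ps s t : supp (P s t) \subset supp x.
  by rewrite !suppD_sub //; apply: fintype.subset_trans (supp_single_edge _ _) _;
    rewrite finset.sub1set.
have PB s t s' t' : N (P s t - P s' t') = `|s - s'| + `|t - t'|.
  have -> : P s t - P s' t' = single_edge e1 ((s - s') *: U) + single_edge e2 ((t - t') *: U).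
    apply/ffunP => f; rewrite !ffunE opprD addrACA subrr add0r opprD addrACA.
    by case: eqP => _; case: eqP => _; rewrite ?scalerBl ?subrr.
  by rewrite N1 norm1_two_edges // !enormZ enorm_delta !mulr1.
have Px s t : 0 <= s <= a -> 0 <= t <= a -> N (P s t - x) < Num.min e r.
  move=> /andP[s0 sa] /andP[t0 ta].
  have -> : x = P 0 0.
    by apply/ffunP => f; rewrite !ffunE !scale0r !if_same !addr0.
  by rewrite PB !subr0 !ger0_norm //; lra.
have Pd s t s' t' : 0 <= s <= a -> 0 <= t <= a -> 0 <= s' <= a -> 0 <= t' <= a ->
    dist (mk (P s t)) (mk (P s' t')) = `|s - s'| + `|t - t'|.
  by move=> hs ht hs' ht'; rewrite c1 ?PB //; apply: lt_le_trans me; exact: Px.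
exists a, (fun s t => mk (P s t)); split=> // s t hs ht; split; last first.
  by move=> s' t' hs' ht'; exact: Pd.
rewrite /dball /= c1 ?subrr ?(norm0 hN) //; last by apply: lt_le_trans me; exact: Px.
rewrite (norm_distC hN); apply: lt_le_trans mr; exact: Px.
Qed.

(** In the chart the ball is Euclidean: straight segments are geodesics, stay inside by convexity,
    and satisfy Stewart's relation with equality. *)
Lemma generic_CAT x : N =1 @norm2 R d n T -> inZ x -> generic F x ->
  exists e k : R, 0 < e /\ CAT dist (dball dist (mk x) e) k.
Proof.
move=> N2 xZ gx; have [e e0 [c1 c2]] := shape_chart xZ gx.
exists e, 0; split=> //.
have ball u : supp u \subset supp x -> N (u - x) < e -> dball dist (mk x) e (mk u).
  move=> us ux; rewrite /dball /= c1 ?subrr ?(norm0 hN) //.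
  by rewrite (norm_distC hN).
have chart p : dball dist (mk x) e p -> exists u, [/\ supp u \subset supp x, mk u = p & N (u - x) < e].
  exact: c2.
apply: (CAT0_stewart shape_refl shape_distC shape_distD).
  move=> p q /chart[u [us <- ux]] /chart[v [vs <- vx]].
  have L : dist (mk u) (mk v) = N (u - v) by exact: c1.
  set l := N (u - v) in L.
  have l0 : 0 <= l := norm_ge0 hN _.
  (* For [l = 0] the quotient [t / l] is [0] and the path is constant. *)
  pose P t := u + (t / l) *: (v - u).
  have PE t : N (P t - x) < e \/ ~ (0 <= t <= l).
    have [/andP[t0 tl]|] := boolP (0 <= t <= l); last by right; exact/negP.
    left; have a0 : 0 <= t / l by rewrite divr_ge0.
    have a1 : t / l <= 1.
      have [->|ln] := eqVneq l 0; first by rewrite invr0 mulr0.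
      by rewrite ler_pdivrMr ?mul1r // lt_neqAle eq_sym ln.
    have -> : P t - x = (1 - t / l) *: (u - x) + (t / l) *: (v - x).
      apply/ffunP => f; rewrite !ffunE; set z := t / l.
      apply/matrixP => i j; rewrite !mxE; ring.
    apply: le_lt_trans (normD hN _ _) _; rewrite !(normZ hN) !ger0_norm ?subr_ge0 //.
    have [a10|a1n] := eqVneq (t / l) 1; first by rewrite a10 subrr mul0r add0r mul1r.
    have a1' : t / l < 1 by rewrite lt_neqAle a1n.
    have n1 : (1 - t / l) * N (u - x) < (1 - t / l) * e by rewrite ltr_pM2l ?subr_gt0.
    have n2 : (t / l) * N (v - x) <= (t / l) * e by rewrite ler_wpM2l // ltW.
    lra.
  have Ps t : supp (P t) \subset supp x by rewrite suppD_sub // suppZ_sub // suppB_sub.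
  exists (fun t => mk (P t)); split.
  - by rewrite /P mul0r scale0r addr0.
  - rewrite L /P; have [ll|ln] := eqVneq l 0.
      have -> : v = u by apply/esym/eqP; rewrite -subr_eq0; apply/eqP; exact: (norm_eq0 hN).
      by rewrite subrr scaler0 addr0.
    by rewrite mulfV // scale1r addrC subrK.
  - by move=> t; rewrite in_itv /= L => tI; apply: ball => //; have [] := PE t.
  - move=> s t; rewrite !in_itv /= L => sI tI.
    rewrite c1 //; [|by have [] := PE s|by have [] := PE t].
    have -> : P s - P t = ((s - t) / l) *: (v - u).
      by rewrite /P opprD addrACA subrr add0r -scalerBl mulrBl.
    rewrite (normZ hN) (norm_distC hN) -/l normrM normfV (ger0_norm l0).
    have [ll|ln] := eqVneq l 0; last by rewrite divfK.
    have -> : s - t = 0 by lra.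
    by rewrite normr0 !mul0r.
move=> p q r a Ap Aq Ar ga t tI.
have [La Lb] := geodesic_dist shape_refl shape_distC shape_distD ga tI.
have [_ _ gA _] := ga.
have Aat : dball dist (mk x) e (a t) by apply: gA; rewrite in_itv.
move: Ap Aq Ar Aat La Lb tI => /chart[u [us <- ux]] /chart[v [vs <- vx]].
move=> /chart[w [ws <- wx]] /chart[m [ms <- mx]].
rewrite !c1 // !N2 => vm mw /andP[t0 tL].
have [L0|Ln] := eqVneq (norm2 (v - w)) 0.
  have -> : t = 0 by lra.
  by rewrite L0 !mul0r subrr !mul0r addr0 subr0.
rewrite (@norm2_stewart R d n T u v w m _ t) //.
by rewrite lt_neqAle eq_sym Ln -N2 norm_ge0.
Qed.

Lemma shape_generically_nonpositively_curved : N =1 @norm2 R d n T ->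
  generically_nonpositively_curved dist.
Proof.
move=> N2; apply: (generically_nonpositively_curved_dilatable shape_refl shape_distC shape_distD).
  exact: shape_dilatable.
move=> p e e0; have [x [xZ gx px]] := mk_dense p e0.
by exists (mk x) => //; exact: generic_CAT.
Qed.

Lemma shape_nowhere_unique : N =1 @norm1 R d n T ->
  (exists2 E, E \in F & (1 < #|E|)%N) -> nowhere_unique_infinitely_curved dist.
Proof.
move=> N1 F1; apply: (nowhere_unique_infinitely_curved_dilatable shape_refl shape_distC shape_distD).
  exact: shape_dilatable.
move=> p e e0; have [x [xZ gx px]] := mk_dense p e0.
have [e1 [e2 [e12 e1x e2x]]] := generic_two_edges F1 xZ gx.
by exists (mk x) => //; exact: (generic_taxicab N1 xZ gx e12).
Qed.

End Shapes.

(** * The quotient metric as a chain metric *)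

Section QuotientDist.
Variables (R : realType) (d n : nat) (T : btree).
Local Notation X := (preshape R d n T).
Variables (N : X -> R) (hN : shape_norm N).
Variable F : {set {set edge T}}.
Local Notation inZ := (restricted_preshape R d n F).
Variables (M : choiceType) (f : M -> X) (dist : M -> M -> R).
Local Notation e := (ker_equiv (fun m : M => collapse (f m))).
Local Notation Q := {eq_quot e}%qT.
Hypothesis fZ : forall m, inZ (f m).
Hypothesis f_surj : forall x, inZ x -> exists m, f m = x.
Hypothesis dist_joinable : forall m m', joinable F (f m) (f m') -> dist m m' <= N (f m - f m').
Hypothesis chain_le_dist : forall m m', chain_dist N F (f m) (f m') <= dist m m'.

Lemma pi_collapse m m' : (\pi m = \pi m' :> Q)%qT <-> collapse (f m) = collapse (f m').
Proof.
by split=> [/eqquotP/asboolP|h]; last apply/eqquotP/asboolP.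
Qed.

Let walk (p q : Q) (l : R) := exists (k : nat) (x y : nat -> M),
    [/\ (\pi_Q (x 0%N) = p)%qT, (forall i, (i < k)%N -> e (y i) (x i.+1)),
        (\pi_Q (y k) = q)%qT & l = \sum_(i < k.+1) dist (x i) (y i)].

Let dist_ge0' m m' : 0 <= dist m m'.
Proof. exact: le_trans (chain_dist_ge0 hN _ _ _) (chain_le_dist _ _). Qed.

Lemma chain_walk m z l : chain N F (f m) z l -> forall m', f m' = z ->
  exists2 l', l' <= l & walk (\pi_Q m)%qT (\pi_Q m')%qT l'.
Proof.
elim=> [|y z' k ch IH z'Z yz|y z' k ch IH yz] m' mz.
(* A walk has at least one step, so the empty chain becomes the null step from [m] to itself. *)
- exists (dist m m).
    by apply: le_trans (dist_joinable (joinable_sub _ (fZ m))) _; rewrite ?subrr ?norm0.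
  exists 0%N, (fun=> m), (fun=> m); split=> //; last by rewrite big_ord1.
  by apply/pi_collapse; rewrite mz.
- have [my myE] := f_surj (chain_inZ ch (fZ m)).
  have [l' l'k [j [x [y' [h1 h2 h3 h4]]]]] := IH my myE.
  exists l' => //; exists j, x, y'; split=> //; rewrite h3.
  by apply/pi_collapse; rewrite myE mz.
- have [my myE] := f_surj (chain_inZ ch (fZ m)).
  have [l' l'k [j [x [y' [h1 h2 h3 h4]]]]] := IH my myE.
  exists (l' + dist my m').
    by apply: lerD => //; rewrite -myE -mz; apply: dist_joinable; rewrite myE mz.
  exists j.+1, (fun i => if (i <= j)%N then x i else my), (fun i => if (i <= j)%N then y' i else m').
  split=> //.
  + move=> i; rewrite ltnS => ij /=; rewrite ij.
    have [lt|ji] := ltnP i j; first exact: h2.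
    have -> : i = j by apply/eqP; rewrite eqn_leq ij.
    by apply/asboolP/pi_collapse.
  + by rewrite ltnn.
  + rewrite big_ord_recr /= ltnn h4; congr (_ + _).
    by apply: eq_bigr => i _; rewrite -ltnS ltn_ord.
Qed.

Lemma walk_chain p q l : walk p q l -> forall m m', p = (\pi_Q m)%qT -> q = (\pi_Q m')%qT ->
  chain_dist N F (f m) (f m') <= l.
Proof.
move=> [k [x [y [<- h2 <- ->]]]] m m' /pi_collapse xm /pi_collapse ym.
rewrite -(chain_dist_eqv2 hN (fZ _) (fZ _) (fZ _) (fZ _) xm ym).
elim: k h2 {ym m'} => [|k IH] h2; first by rewrite big_ord1.
rewrite big_ord_recr /=.
apply: le_trans (chain_distD hN (fZ _) (fZ (x k.+1)) (fZ _)) _.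
apply: lerD => //.
have /asboolP yx := h2 k (ltnSn k).
rewrite -(chain_dist_eqv2 hN (fZ _) (fZ _) (fZ _) (fZ _) erefl yx).
by apply: IH => i ik; apply: h2; rewrite ltnS ltnW.
Qed.

(** [dist] is at least the chain distance and, on joinable pairs, at most the norm distance. So no
    walk is shorter than the chain distance, and each chain yields a walk that is no longer. *)
Lemma quotient_distE m m' :
  quotient_dist dist (\pi_Q m)%qT (\pi_Q m')%qT = chain_dist N F (f m) (f m').
Proof.
have lb : has_lbound (walk (\pi_Q m)%qT (\pi_Q m')%qT).
  by exists 0 => l [k [x [y [_ _ _ ->]]]]; apply: sumr_ge0 => i _.
have ne : walk (\pi_Q m)%qT (\pi_Q m')%qT !=set0.
  have [l /chain_walk/(_ m' erefl)[l' _ w]] := chain_exists N (fZ m) (fZ m').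
  by exists l'.
apply/eqP; rewrite eq_le; apply/andP; split.
  apply: chain_dist_glb => // l /chain_walk/(_ m' erefl)[l' ll w].
  exact: le_trans (ge_inf lb w) ll.
by apply: lb_le_inf => // l w; exact: walk_chain w _ _ erefl erefl.
Qed.

Lemma quotient_rep (dt : Q -> Q -> R) : F != finset.set0 -> dt = quotient_dist dist ->
  exists (rep : Q -> X) (mk : X -> Q),
   [/\ forall p, inZ (rep p),
    forall p q, dt p q = chain_dist N F (rep p) (rep q),
    forall x, inZ x -> collapse (rep (mk x)) = collapse x &
    forall x p, inZ x -> collapse x = collapse (rep p) -> mk x = p].
Proof.
move=> F0 ->.
pose rep (p : Q) := f (repr p).
have [mk mkP] : exists mk : X -> Q, forall x, inZ x -> exists2 m, f m = x & mk x = (\pi_Q m)%qT.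
  have [m0 _] := f_surj (inZ0 R d n F0).
  have ch x : exists q : Q, inZ x -> exists2 m, f m = x & q = (\pi_Q m)%qT.
    have [xZ|xZ] := pselect (inZ x); last by exists (\pi_Q m0)%qT.
    by have [m mx] := f_surj xZ; exists (\pi_Q m)%qT => _; exists m.
  by have [mk mkP] := choice ch; exists mk.
exists rep, mk; split=> [p|p q|x /mkP[m <- ->]|x p /mkP[m <- ->] h].
- exact: fZ.
- by rewrite -quotient_distE !reprK.
- by apply/pi_collapse; rewrite reprK.
- by rewrite -[RHS]reprK; apply/pi_collapse.
Qed.

End QuotientDist.

(** * The length metric of the restricted pre-shape space *)

Section LengthDist.
Variables (R : realType) (d n : nat) (T : btree).
Local Notation X := (preshape R d n T).
Variables (N : X -> R) (hN : shape_norm N) (dist : X -> X -> R).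
Hypothesis distE : forall x y, dist x y = N (x - y).
Variable F : {set {set edge T}}.
Local Notation inZ := (restricted_preshape R d n F).
Implicit Types (g : R -> X) (a : R).

Definition variation g a s :=
  \sum_(i < size s) dist (g (nth 0 (a :: s) i)) (g (nth 0 s i)).

Lemma variation_cons g a b s : variation g a (b :: s) = dist (g a) (g b) + variation g b s.
Proof. by rewrite /variation big_ord_recl. Qed.

Lemma variation_rcons g a s b :
  variation g a (rcons s b) = variation g a s + dist (g (last a s)) (g b).
Proof.
elim: s a => [|c s IH] a /=.
  by rewrite variation_cons /variation !big_ord0 addr0 add0r.
by rewrite !variation_cons IH addrA.
Qed.

Definition lipschitz01 g (K : R) := forall s t : R, 0 <= s -> s <= t -> t <= 1 ->
  dist (g s) (g t) <= K * (t - s).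

Lemma lipschitz_variation g K a s : lipschitz01 g K -> 0 <= a -> path <%R a s ->
  last a s <= 1 -> variation g a s <= K * (last a s - a).
Proof.
move=> gK; elim: s a => [|b s IH] a a0 /=.
  by rewrite /variation big_ord0 subrr mulr0.
move=> /andP[ab bs] l1; rewrite variation_cons.
have bl : b <= last b s.
  elim: s b bs {IH ab l1} => //= c s IHs b /andP[bc cs].
  exact: le_trans (ltW bc) (IHs c cs).
have b0 : 0 <= b by lra.
have h1 := IH b b0 bs l1; have h2 := gK a b a0 (ltW ab) ltac:(lra).
have -> : K * (last b s - a) = K * (b - a) + K * (last b s - b) by ring.
lra.
Qed.

Lemma lipschitz_is_path g K x y : 0 <= K -> lipschitz01 g K -> g 0 = x -> g 1 = y ->
  (forall t, 0 <= t <= 1 -> inZ (g t)) -> is_path dist inZ x y g.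
Proof.
move=> K0 gK g0 g1 gZ; split=> //.
move=> s; rewrite in_itv /= => /andP[s0 s1].
apply/cvgr0Pnorm_lt => e e0; rewrite near_withinE.
have K1 : 0 < K + 1 by lra.
have eK : 0 < e / (K + 1) by rewrite divr_gt0.
near=> t; rewrite /= in_itv /= => /andP[t0 t1].
have st : `|s - t| < e / (K + 1) by near: t; exact: nbhsx_ballx.
have dst : dist (g s) (g t) <= K * `|s - t|.
  have [le|le] := leP s t.
    by rewrite distrC ger0_norm ?subr_ge0 //; exact: gK.
  rewrite ger0_norm; last by lra.
  by rewrite distE (norm_distC hN) -distE; apply: gK => //; exact: ltW.
rewrite ger0_norm; last by rewrite distE norm_ge0.
apply: le_lt_trans dst _; rewrite ltr_pdivlMr // in st.
have := normr_ge0 (s - t); lra.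
Unshelve. all: end_near. Qed.

Lemma path_length_variation g :
  path_length dist g = ereal_sup [set (variation g 0 s)%:E | s in itv_partition 0 1].
Proof. by []. Qed.

Lemma lipschitz_path_length g K : lipschitz01 g K -> (path_length dist g <= K%:E)%E.
Proof.
move=> gK; rewrite path_length_variation; apply: ge_ereal_sup => _ [s [s01 /eqP sl] <-].
rewrite lee_fin; apply: le_trans (lipschitz_variation gK (lexx 0) s01 _) _; rewrite sl //.
by rewrite subr0 mulr1.
Qed.

(** By continuity the nonzero edges of [g s] stay nonzero at nearby times, so nearby points of the
    path are joinable; a supremum argument then covers the interval. *)
Lemma chain_dist_le_path_length g x y : is_path dist inZ x y g ->
  ((chain_dist N F x y)%:E <= path_length dist g)%E.
Proof.
move=> [g0 g1 gZ gc].
have gZ' t : 0 <= t <= 1 -> inZ (g t) by move=> tI; apply: gZ; rewrite in_itv.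
have loc s : 0 <= s <= 1 -> exists2 e : R, 0 < e & forall t, 0 <= t <= 1 ->
    `|s - t| < e -> joinable F (g s) (g t) /\ joinable F (g t) (g s).
  move=> sI; have [eta eta0 sep] := separatingP hN (g s).
  have := gc s; rewrite in_itv /= => /(_ sI)/cvgr0Pnorm_lt/(_ eta eta0).
  rewrite near_withinE => /nbhs_ballP[e e0 he]; exists e => // t tI st.
  have := he t st; rewrite /= in_itv /= => /(_ tI).
  rewrite ger0_norm ?distE ?norm_ge0 // => h.
  have st' : supp (g s) \subset supp (g t).
    by apply: (sep (g s) erefl).1; rewrite (norm_distC hN).
  have j := joinable_sub st' (gZ' t tI).
  by split=> //; exact: joinableC.
(* Times up to which some partition has a variation bounding the chain distance from [g 0]; the
   supremum is shown to belong to [S] and to equal [1]. *)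
pose S : set R := [set t | 0 <= t <= 1 /\ exists s, [/\ path <%R 0 s, last 0 s = t &
   chain_dist N F (g 0) (g t) <= variation g 0 s]].
have S0 : S 0.
  split; first by rewrite lexx ler01.
  exists [::]; split=> //; rewrite /variation big_ord0 chain_dist_eqv //.
  by apply: gZ'; rewrite lexx ler01.
have ext t t' : S t -> t < t' -> t' <= 1 -> joinable F (g t) (g t') -> S t'.
  move=> [/andP[t0 t1] [s [ps ls hs]]] tt' t'1 j.
  have t'I : 0 <= t' <= 1 by apply/andP; split; lra.
  split=> //; exists (rcons s t'); split; rewrite ?last_rcons //.
    by rewrite rcons_path ps ls.
  rewrite variation_rcons ls distE.
  apply: le_trans (chain_distD hN (gZ' 0 _) (gZ' t _) (gZ' t' t'I)) _; rewrite ?lexx ?ler01 //.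
    by apply/andP.
  by apply: lerD => //; exact: chain_dist_joinable.
have S1 t : S t -> 0 <= t <= 1 by case.
have Sne : S !=set0 by exists 0.
have Sub : has_ubound S by exists 1 => t /S1/andP[].
have Ssup : has_sup S by split.
pose tau := sup S.
have tauI : 0 <= tau <= 1.
  rewrite (ub_le_sup Sub S0) /=; apply: ge_sup => // t /S1/andP[]//.
have [e e0 he] := loc tau tauI.
have Stau : S tau.
  have [t St tt] := sup_adherent e0 Ssup; have tle := ub_le_sup Sub St.
  have [tE|tn] := eqVneq t tau; first by rewrite -tE.
  have tI := S1 t St.
  have [|_ j] := he t tI; first by rewrite ger0_norm ?subr_ge0 // /tau; lra.
  apply: (ext t) => //; last by case/andP: tauI.
  by rewrite lt_neqAle tn.
have tau1 : tau = 1.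
  apply/eqP; rewrite eq_le; case/andP: (tauI) => t0 -> /=; rewrite leNgt; apply/negP => tlt.
  pose t := Num.min 1 (tau + e / 2).
  have tt : tau < t by rewrite lt_min tlt /=; lra.
  have t1 : t <= 1 by rewrite ge_min lexx.
  have te : t <= tau + e / 2 by rewrite ge_min lexx orbT.
  have tI : 0 <= t <= 1 by apply/andP; split; lra.
  have [|j _] := he t tI; first by rewrite ltr0_norm; lra.
  have St : S t by exact: ext tt t1 j.
  by have := ub_le_sup Sub St; rewrite leNgt tt.
have [_ [s [ps ls hs]]] := Stau.
rewrite tau1 in ls hs; rewrite -g0 -g1 path_length_variation.
apply: (@le_trans _ _ (variation g 0 s)%:E); first by rewrite lee_fin.
by apply: ereal_sup_ubound; exists s => //; split=> //; rewrite ls.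
Qed.

Let lpath x y := [set path_length dist g | g in is_path dist inZ x y].

Lemma lipschitz_length_dist g K x y : 0 <= K -> lipschitz01 g K -> g 0 = x -> g 1 = y ->
  (forall t, 0 <= t <= 1 -> inZ (g t)) -> (ereal_inf (lpath x y) <= K%:E)%E.
Proof.
move=> K0 gK g0 g1 gZ; apply: le_trans (lipschitz_path_length gK).
by apply: ereal_inf_lbound; exists g => //; exact: (lipschitz_is_path K0 gK).
Qed.

Lemma segment_length x y : joinable F x y -> (ereal_inf (lpath x y) <= (N (x - y))%:E)%E.
Proof.
move=> [E EF [xE yE]].
apply: (@lipschitz_length_dist (fun t => x + t *: (y - x))).
- exact: norm_ge0.
- move=> s t s0 st t1; rewrite distE opprD addrACA subrr add0r -scalerBl.
  by rewrite (normZ hN) (norm_distC hN y) distrC ger0_norm ?subr_ge0 // mulrC.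
- by rewrite scale0r addr0.
- by rewrite scale1r addrC subrK.
- by move=> t _; apply/inZP; exists E => //; apply: supp_homothety.
Qed.

Lemma length_finite x y : inZ x -> inZ y -> exists K, (ereal_inf (lpath x y) <= K%:E)%E.
Proof.
move=> xZ yZ; pose pos (t : R) := Num.max t 0.
have posL s t : s <= t -> 0 <= pos t - pos s <= t - s.
  by move=> st; rewrite /pos; case: (leP s 0) => hs; case: (leP t 0) => ht; apply/andP; split; lra.
exists (2 * (N x + N y)).
(* The first weight vanishes from time [1 / 2] on and the second up to it, so the path runs through
   the origin. *)
apply: (@lipschitz_length_dist (fun t => pos (1 - 2 * t) *: x + pos (2 * t - 1) *: y)).
- by rewrite mulr_ge0 // addr_ge0 // norm_ge0.
- move=> s t s0 st t1; rewrite distE opprD addrACA -!scalerBl.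
  apply: le_trans (normD hN _ _) _; rewrite !(normZ hN).
  have /andP[h1 h2] := posL (1 - 2 * t) (1 - 2 * s) ltac:(lra).
  have /andP[h3 h4] := posL (2 * s - 1) (2 * t - 1) ltac:(lra).
  rewrite (ger0_norm h1) distrC (ger0_norm h3).
  have n1 : (pos (1 - 2 * s) - pos (1 - 2 * t)) * N x <= 2 * (t - s) * N x.
    by apply: ler_wpM2r; [exact: norm_ge0|lra].
  have n2 : (pos (2 * t - 1) - pos (2 * s - 1)) * N y <= 2 * (t - s) * N y.
    by apply: ler_wpM2r; [exact: norm_ge0|lra].
  lra.
- rewrite /pos mulr0 subr0 sub0r max_l ?ler01 // max_r ?scale0r ?addr0 ?scale1r //; lra.
- have -> : pos (1 - 2 * 1) = 0 by rewrite /pos max_r //; lra.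
  have -> : pos (2 * 1 - 1) = 1 by rewrite /pos max_l; lra.
  by rewrite scale0r scale1r add0r.
- move=> t _; have [h|h] := leP t (1 / 2).
    rewrite [pos (2 * t - 1)]max_r ?scale0r ?addr0; last by lra.
    by apply: inZ_supp xZ; exact: suppZ_sub.
  rewrite [pos (1 - 2 * t)]max_r ?scale0r ?add0r; last by lra.
  by apply: inZ_supp yZ; exact: suppZ_sub.
Qed.

(** The infimum lies between the chain distance and a finite bound, so [fine] loses nothing. *)
Lemma length_distE x y : inZ x -> inZ y ->
  ((chain_dist N F x y)%:E <= (length_dist dist inZ x y)%:E)%E /\
  (length_dist dist inZ x y)%:E = ereal_inf (lpath x y).
Proof.
move=> xZ yZ; have [K hK] := length_finite xZ yZ.
have h : ((chain_dist N F x y)%:E <= ereal_inf (lpath x y))%E.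
  by apply: le_ereal_inf_tmp => _ [g gp <-]; exact: chain_dist_le_path_length.
have fin : ereal_inf (lpath x y) \is a fin_num.
  by rewrite fin_numE -ltNye -ltey (lt_le_trans (ltNyr _) h) (le_lt_trans hK (ltry _)).
by rewrite /length_dist fineK.
Qed.

Lemma chain_dist_le_length_dist x y : inZ x -> inZ y ->
  chain_dist N F x y <= length_dist dist inZ x y.
Proof. by move=> xZ yZ; rewrite -lee_fin; exact: (length_distE xZ yZ).1. Qed.

Lemma length_dist_joinable x y : inZ x -> inZ y -> joinable F x y ->
  length_dist dist inZ x y <= N (x - y).
Proof.
by move=> xZ yZ j; rewrite -lee_fin (length_distE xZ yZ).2; exact: segment_length.
Qed.

End LengthDist.

(** * The full and the restricted shape spaces *)

Section Spaces.
Variables (R : realType) (d n : nat) (T : btree).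
Local Notation X := (preshape R d n T).
Variables (N : X -> R) (hN : shape_norm N) (dist : X -> X -> R).
Hypothesis distE : forall x y, dist x y = N (x - y).

(** The full space is the case where every edge set is allowed and all pairs are joinable. *)
Lemma tree_shape_rep (dt : tree_shape R d n T -> tree_shape R d n T -> R) :
  dt = quotient_dist dist ->
  exists (rep : tree_shape R d n T -> X) (mk : X -> tree_shape R d n T),
   [/\ forall p, restricted_preshape R d n [set: {set edge T}] (rep p),
    forall p q, dt p q = chain_dist N [set: {set edge T}] (rep p) (rep q),
    forall x, restricted_preshape R d n [set: {set edge T}] x -> collapse (rep (mk x)) = collapse x &
    forall x p, restricted_preshape R d n [set: {set edge T}] x ->
      collapse x = collapse (rep p) -> mk x = p].
Proof.
have allZ x : restricted_preshape R d n [set: {set edge T}] x.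
  by apply/inZP; exists (finset.setT); rewrite ?finset.inE // finset.subsetT.
have allJ x y : joinable [set: {set edge T}] x y.
  by exists (finset.setT); rewrite ?finset.inE // !finset.subsetT.
apply: (quotient_rep hN (f := id)) => //.
- by move=> x _; exists x.
- by move=> x y _; rewrite distE.
- by move=> x y; rewrite distE; exact: chain_dist_joinable.
- by apply/set0Pn; exists finset.set0; rewrite finset.inE.
Qed.

Lemma restricted_shape_rep (F : {set {set edge T}})
  (dt : restricted_shape R d n F -> restricted_shape R d n F -> R) :
  F != finset.set0 -> dt = quotient_dist (fun x y : restricted_preshape R d n F =>
    length_dist dist (restricted_preshape R d n F) (val x) (val y)) ->
  exists (rep : restricted_shape R d n F -> X) (mk : X -> restricted_shape R d n F),
   [/\ forall p, restricted_preshape R d n F (rep p),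
    forall p q, dt p q = chain_dist N F (rep p) (rep q),
    forall x, restricted_preshape R d n F x -> collapse (rep (mk x)) = collapse x &
    forall x p, restricted_preshape R d n F x ->
      collapse x = collapse (rep p) -> mk x = p].
Proof.
have vZ (x : restricted_preshape R d n F) : restricted_preshape R d n F (val x).
  exact: set_valP.
apply: (quotient_rep hN (f := fun x : restricted_preshape R d n F => val x)) => //.
- by move=> x xZ; exists (SigSub (mem_set xZ)).
- by move=> x y; exact: length_dist_joinable.
- by move=> x y; exact: chain_dist_le_length_dist.
Qed.

End Spaces.

Theorem theorem28 (R : realType) (d n : nat) (T : btree)
    (hd : (0 < d)%N) (hn : (0 < n)%N) (hT : (0 < #|edge T|)%N) :
  [/\ generically_nonpositively_curved (@QED R d n T),
      nowhere_unique_infinitely_curved (@TED R d n T) &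
      forall F : {set {set edge T}},
        F != finset.set0 -> topology_closed F ->
        generically_nonpositively_curved (@restricted_QED R d n T F) /\
        ((exists2 E : {set edge T}, E \in F & (1 < #|E|)%N) ->
         nowhere_unique_infinitely_curved (@restricted_TED R d n T F))].
Proof.
have N1 := shape_norm1 R d n T; have N2 := shape_norm2 R d n T.
(* A tree with an edge has both edges at its root, which gives the two directions of a taxicab
   square. *)
have two : exists2 E : {set edge T}, E \in [set: {set edge T}]%SET & (1 < #|E|)%N.
  exists finset.setT; rewrite ?finset.inE // cardsT.
  case: T hT {N1 N2} => [|l r] h; first by rewrite card_void in h.
  by rewrite [edge _]/= card_sum !card_option addSn addnS.
split.
- have [rep [mk [h1 h2 h3 h4]]] := tree_shape_rep N2 (@dist2E R d n T) erefl.
  exact: (shape_generically_nonpositively_curved N2 h1 h2 h3 h4).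
- have [rep [mk [h1 h2 h3 h4]]] := tree_shape_rep N1 (@dist1E R d n T) erefl.
  exact: (shape_nowhere_unique N1 h1 h2 h3 h4).
- move=> F F0 _; split=> [|F1].
    have [rep [mk [h1 h2 h3 h4]]] := restricted_shape_rep N2 (@dist2E R d n T) F0 erefl.
    exact: (shape_generically_nonpositively_curved N2 h1 h2 h3 h4).
  have [rep [mk [h1 h2 h3 h4]]] := restricted_shape_rep N1 (@dist1E R d n T) F0 erefl.
  exact: (shape_nowhere_unique N1 h1 h2 h3 h4).
Qed.
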